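(* Let $N\ge2$, $\eta\ge0$, $\rho>0$, $K>0$, $\sigma>0$, $x\in\mathbb R$, and let $X_t=x+\sigma B_t$ with $B$ a standard Brownian motion. Consider the $N$-player stopping game in which each player $i$ chooses a stopping time $\tau_i\in\mathcal T$ and receives $$J_i(\tau_1,\dots,\tau_N)=\mathbb E_x\big[e^{-\rho\tau_i}(X_{\tau_i}-K)^+\big]+\frac{\eta}{N-1}\sum_{j\ne i}\mathbb E_x\big[e^{-\rho\tau_j}(X_{\tau_j}-K)^+\big].$$ This game is an exact potential game with potential function $$\Phi(\tau_1,\dots,\tau_N)=\sum_{i=1}^N\mathbb E_x\big[e^{-\rho\tau_i}(X_{\tau_i}-K)^+\big].$$ Moreover, a Nash equilibrium is given by $\tau_1^*=\dots=\tau_N^*=\tau^*$ with $$\tau^*:=\inf\{t\ge0:X_t\ge x^*\},\qquad x^*=K+\frac{\sigma}{\sqrt{2\rho}} .$$ The corresponding single-agent value function is $$V_{\mathrm{exact}}(x)=\sup_{\tau\in\mathcal T}\mathbb E_x\big[e^{-\rho\tau}(X_\tau-K)^+\big]=\begin{cases}x-K,&x\ge x^*,\\ (x^*-K)\exp\!\Big(\dfrac{\sqrt{2\rho}}{\sigma}(x-x^* )\Big),&x<x^*,\end{cases}$$ and hence the equilibrium potential value $\Phi^*(x):=\Phi(\tau^*,\dots,\tau^* )$ equals $N\,V_{\mathrm{exact}}(x)$.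
   Context: $\mathcal T$ is the set of (finite-valued, $[0,\infty)$-valued) stopping times of the usual augmentation of the filtration generated by $X$; $\mathbb E_x$ denotes expectation when $X_0=x$. The game is an exact potential game with potential function $\Phi:\mathcal T^N\to\mathbb R$ if $J_i(\tau_i',\tau_{-i})-J_i(\tau_i,\tau_{-i})=\Phi(\tau_i',\tau_{-i})-\Phi(\tau_i,\tau_{-i})$ for every $i$, every profile $\tau\in\mathcal T^N$ and every $\tau_i'\in\mathcal T$. A profile $\tau$ is a Nash equilibrium if $J_i(\tau)\ge J_i(\tau_i',\tau_{-i})$ for every $i$ and every $\tau_i'\in\mathcal T$. ($\tau^*$ is a.s. finite.) *)

(* Defs.v *)
From HB Require Import structures.
From mathcomp Require Import all_boot all_order all_algebra.
From mathcomp Require Import all_classical all_reals all_analysis.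

Set Implicit Arguments.
Unset Strict Implicit.
Unset Printing Implicit Defensive.
Import Order.TTheory GRing.Theory Num.Theory.
Import numFieldNormedType.Exports.

Local Open Scope classical_set_scope.
Local Open Scope ring_scope.

(* The completion of P, as a probability measure on the Caratheodory
   sigma-algebra of the outer measure induced by P (for a finite measure this
   is the sigma-algebra generated by the measurable and the P-negligible sets).
   It is needed because stopping times of the augmented filtration are only
   measurable for the completed sigma-algebra; if P is complete it is P. *)
Section completion.
Context (d : measure_display) (Omega : measurableType d) (R : realType).
Variable P : probability Omega R.

Let completionT := caratheodory_type (P^*)%mu.

Definition completion : set completionT -> \bar R :=
  @completed_measure_extension d Omega R P.

HB.instance Definition _ := Measure.on completion.

Let completion_setT : completion setT = 1%E.
Proof.
by rewrite /completion /completed_measure_extension measurable_mu_extE//= probability_setT.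
Qed.

HB.instance Definition _ :=
  Measure_isProbability.Build _ completionT R completion completion_setT.

End completion.
Arguments completion {d Omega R} P _.

(* Processes are indexed by R; only the times t >= 0 are ever used. *)
Section processes.
Context (d : measure_display) (Omega : measurableType d) (R : realType).
Implicit Types (P : probability Omega R) (B X : R -> Omega -> R).

(* normal_prob takes the standard deviation, hence the square root. *)
Record standard_brownian_motion P B : Prop := StandardBrownianMotion {
  bm_measurable : forall t : R, 0 <= t -> measurable_fun setT (B t) ;
  bm_start : {ae P, forall w, B 0 w = 0} ;
  bm_independent_increments :
    forall (n : nat) (t : nat -> R) (A : nat -> set R),
      0 <= t 0%N -> (forall k, t k <= t k.+1) ->
      (forall k, measurable (A k)) ->
      P [set w | forall k, (k < n)%N -> A k (B (t k.+1) w - B (t k) w)] =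
      (\prod_(k < n) P [set w | A k (B (t k.+1) w - B (t k) w)%R])%E ;
  bm_normal_increments :
    forall (s t : R) (A : set R), 0 <= s -> s < t -> measurable A ->
      P [set w | A (B t w - B s w)] = normal_prob 0 (Num.sqrt (t - s)) A ;
  bm_continuous :
    {ae P, forall w, {within `[0, +oo[, continuous (fun t => B t w)}}
}.

Definition natural_filtration X (t : R) : set (set Omega) :=
  <<s \bigcup_(u in `[0, t]) preimage_set_system setT (X u) measurable >>.

(* Null sets are the subsets of the measurable sets of probability 0, added to
   the natural filtration before taking right limits. *)
Definition usual_augmentation P X (t : R) : set (set Omega) :=
  \bigcap_(s in [set s : R | t < s])
    <<s natural_filtration X s `|` P.-negligible >>.

Definition stopping_time P X : set (Omega -> R) :=
  [set tau | (forall w, 0 <= tau w) /\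
     (forall t : R, 0 <= t -> usual_augmentation P X t [set w | tau w <= t])].

(* Equal to +oo on the paths that never reach [a, +oo[. *)
Definition hitting_time X (a : R) (w : Omega) : \bar R :=
  ereal_inf [set t%:E | t in [set t : R | 0 <= t /\ a <= X t w]].

Definition scaled_brownian (x sigma : R) B (t : R) (w : Omega) : R :=
  x + sigma * B t w.

Definition call_reward (rho K : R) X (tau : Omega -> R) (w : Omega) : R :=
  expR (- rho * tau w) * Num.max (X (tau w) w - K) 0.

Definition expected_reward P (rho K : R) X (tau : Omega -> R) : \bar R :=
  'E_(completion P)[call_reward rho K X tau].

Definition value P (rho K : R) X : \bar R :=
  ereal_sup [set expected_reward P rho K X tau | tau in stopping_time P X].

Definition J (N : nat) P (rho K eta : R) X (i : 'I_N)
    (tau : 'I_N -> Omega -> R) : R :=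
  fine (expected_reward P rho K X (tau i)) +
  eta / (N%:R - 1) *
    \sum_(j < N | j != i) fine (expected_reward P rho K X (tau j)).

Definition Phi (N : nat) P (rho K : R) X (tau : 'I_N -> Omega -> R) : R :=
  \sum_(i < N) fine (expected_reward P rho K X (tau i)).

End processes.

(* In the games below every player has the same strategy set S. *)
Section games.
Context (R : realType) (N : nat) (A : Type).
Implicit Types (S : set A) (u : 'I_N -> ('I_N -> A) -> R).

Definition deviation (tau : 'I_N -> A) (i : 'I_N) (s : A) : 'I_N -> A :=
  fun j => if j == i then s else tau j.

Definition exact_potential_game S u (F : ('I_N -> A) -> R) : Prop :=
  forall (i : 'I_N) (tau : 'I_N -> A) (s : A), (forall j, S (tau j)) -> S s ->
    u i (deviation tau i s) - u i tau = F (deviation tau i s) - F tau.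

Definition nash_equilibrium S u (tau : 'I_N -> A) : Prop :=
  (forall j, S (tau j)) /\
  (forall (i : 'I_N) (s : A), S s -> u i (deviation tau i s) <= u i tau).

End games.

(* Main.v *)
(** Rewards are additively separable, so a deviation of player i changes J_i and Phi
    by the same amount and the whole statement reduces to the single-agent optimal
    stopping problem.  That problem is solved with the exponential martingales
    M_t = exp (theta B_t - theta^2 t / 2) alone.

    Upper bound: Fatou's lemma along discretised stopping times gives E M_tau <= 1
    for every stopping time tau and every theta.  For theta = sqrt (2 rho), the
    payoff (x + sigma b - K)^+ is dominated by some a1 e^(theta b) + a2 e^(- theta b)
    with a1, a2 >= 0 and a1 + a2 = V(x), whence E [e^(- rho tau) (X_tau - K)^+] <= V(x).

    Attainment: M is bounded up to the hitting time tau of a level a > 0, so E M = 1 at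
    min (tau, n); letting n tend to infinity, E [e^(- theta^2 tau / 2); tau < oo] =
    e^(- theta a).  Letting theta tend to 0 shows that tau is almost surely finite, and
    theta = sqrt (2 rho) gives the reward of tau.

    The martingale property rests on the independence of B_t - B_s from the augmented
    sigma-algebra at time s, obtained from the independence of increments by two
    applications of the pi-lambda theorem (the increments along one grid, then
    cylinder sets up to null sets).  Everything is done on the completed space, after
    modifying B on a null set so that all its paths are continuous. *)

Require Import Defs.
From HB Require Import structures.
From mathcomp Require Import all_boot all_order all_algebra.
From mathcomp Require Import all_classical all_reals all_analysis.
From mathcomp Require Import measurable_realfun ring lra.
Import Order.TTheory GRing.Theory Num.Theory.
Import numFieldNormedType.Exports.
Local Open Scope classical_set_scope.
Local Open Scope ring_scope.

Set Implicit Arguments.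
Unset Strict Implicit.
Unset Printing Implicit Defensive.

(** * Exponential moments of the normal law *)

Lemma ge0_integral_normal_prob (R : realType) (m s : R) (f : R -> \bar R) :
  (forall y, (0 <= f y)%E) -> measurable_fun [set: R] f ->
  (\int[normal_prob m s]_y f y =
   \int[lebesgue_measure]_y (f y * (normal_pdf m s y)%:E))%E.
Proof.
move=> f0 mf; have dom := normal_prob_dominates m s.
rewrite -(Radon_Nikodym_SigmaFinite.change_of_variables dom)//.
apply: ae_eq_integral => //.
- apply: emeasurable_funM => //.
  exact: measurable_int (Radon_Nikodym_SigmaFinite.f_integrable dom).
- apply: (emeasurable_funM mf (g := EFin \o normal_pdf m s)).
  by apply: measurableT_comp => //; exact: measurable_normal_pdf.
(* The Radon-Nikodym derivative and [normal_pdf] have the same integral over every measurable set,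
   so they agree almost everywhere. *)
- have : ae_eq lebesgue_measure setT
      (Radon_Nikodym_SigmaFinite.f (normal_prob m s) lebesgue_measure)
      (EFin \o normal_pdf m s).
    apply: integral_ae_eq => //.
    + exact: Radon_Nikodym_SigmaFinite.f_integrable.
    + by apply: measurableT_comp => //; exact: measurable_normal_pdf.
    + move=> E _ mE.
      by rewrite -(Radon_Nikodym_SigmaFinite.f_integral dom).
  by apply: filterS => y /(_ I) + _ => ->.
Qed.

(** Completing the square: the exponential factor turns the centred normal density of variance [v]
    into the normal density of mean [theta * v] and the same variance, which has mass 1. *)
Lemma integral_expR_normal_prob (R : realType) (theta v : R) : 0 < v ->
  (\int[normal_prob 0 (Num.sqrt v)]_y
     (expR (theta * y - theta ^+ 2 * v / 2))%:E = 1)%E.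
Proof.
move=> v0.
have sv0 : Num.sqrt v != 0 by rewrite gt_eqF// sqrtr_gt0.
rewrite ge0_integral_normal_prob; last 2 first.
- by move=> y; rewrite lee_fin expR_ge0.
- apply/measurable_EFinP/measurableT_comp => //.
  by apply: measurable_funB => //; exact: measurable_funM.
rewrite -[RHS](integral_normal_pdf (theta * v) (Num.sqrt v)).
apply: eq_integral => y _; rewrite -EFinM; congr EFin.
rewrite !normal_pdfE// mulrCA /normal_fun -expRD; congr (_ * expR _).
rewrite sqr_sqrtr ?ltW//; field.
by rewrite gt_eqF.
Qed.

(** * Independence *)

Section independence.
Context (d : measure_display) (T : measurableType d) (R : realType).
Variable P : probability T R.

(** Pi-lambda argument: the measurable sets independent of [E] form a Dynkin system, and [G] is a
    pi-system inside it. *)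
Lemma g_sigma_algebra_independent (G : set (set T)) (E : set T) :
  measurable E -> setI_closed G -> G `<=` measurable ->
  (forall A, G A -> P (A `&` E) = P A * P E)%E ->
  forall A, <<s G >> A -> measurable A /\ (P (A `&` E) = P A * P E)%E.
Proof.
move=> mE GI Gm GE; rewrite -(setI_closed_g_dynkin_g_sigma_algebra GI).
apply: smallest_sub => [|A GA]; last by split; [exact: Gm|exact: GE].
split => /=.
- by split=> //; rewrite setTI probability_setT mul1e.
- move=> A [mA AE]; split; first exact: measurableC.
  have -> : ~` A `&` E = E `\` (A `&` E).
    by rewrite setDIr setDv setU0 setDE setIC.
  rewrite measureD//; last 2 first.
  - exact: measurableI.
  - by rewrite (le_lt_trans (probability_le1 _ _))// ltry.
  have -> : E `&` (A `&` E) = A `&` E by rewrite setIC -setIA setIid.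
  rewrite [X in (_ - X)%E]AE.
  rewrite probability_setC// muleBl ?mul1e//.
    by rewrite fin_num_measure.
- move=> F tF mF.
  have mFn n : measurable (F n) by have [] := mF n.
  split; first exact: bigcupT_measurable.
  rewrite setI_bigcupl measure_bigcup//; last 2 first.
  - by move=> n _; exact: measurableI.
  - exact: trivIset_setIr.
  have PE : P E = (fine (P E))%:E by rewrite fineK// fin_num_measure.
  rewrite measure_bigcup// muleC PE -nneseriesZl//.
  by apply: eq_eseriesr => n _; rewrite -PE muleC; have [] := mF n.
Qed.

(** Independence identifies the joint law of [U] and [Y] with the product of their laws; Tonelli's
    theorem then factorises the integral. *)
Lemma ge0_integralM_independent (U Y : T -> R) (g : R -> R) :
  measurable_fun setT U -> measurable_fun setT Y -> measurable_fun setT g ->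
  (forall w, 0 <= U w) -> (forall y, 0 <= g y) ->
  (forall C D, measurable C -> measurable D ->
    P (U @^-1` C `&` Y @^-1` D) = P (U @^-1` C) * P (Y @^-1` D))%E ->
  (\int[P]_w (U w * g (Y w))%:E =
   \int[P]_w (U w)%:E * \int[P]_w (g (Y w))%:E)%E.
Proof.
move=> mU mY mg U0 g0 ind.
have mUY : measurable_fun setT (fun w => (U w, Y w)) by exact: measurable_fun_pair.
pose U' : {mfun T >-> R} := HB.pack U (isMeasurableFun.Build _ _ _ _ U mU).
pose Y' : {mfun T >-> R} := HB.pack Y (isMeasurableFun.Build _ _ _ _ Y mY).
pose UY : {mfun T >-> (R * R)%type} :=
  HB.pack (fun w => (U w, Y w)) (isMeasurableFun.Build _ _ _ _ _ mUY).
(* The absolute value makes [h] nonnegative on the whole plane; it changes nothing along [U], which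
   is nonnegative. *)
pose h (z : R * R) := (`|z.1| * g z.2)%:E.
have mg2 : measurable_fun setT (fun z : R * R => g z.2).
  exact: measurableT_comp mg measurable_snd.
have mh : measurable_fun setT h.
  by apply/measurable_EFinP/measurable_funM => //; exact: measurableT_comp.
have h0 z : (0 <= h z)%E by rewrite lee_fin mulr_ge0.
have mgE : measurable_fun setT (EFin \o g) by exact/measurable_EFinP.
transitivity (\int[distribution P UY]_z h z)%E.
  rewrite ge0_integral_distribution//.
  by apply: eq_integral => w _; rewrite /= /h/= ger0_norm.
transitivity (\int[distribution P U' \x distribution P Y']_z h z)%E.
  apply: eq_measure_integral => A mA _; apply/esym.
  by apply: product_measure_unique => // C D mC mD; exact: ind.
rewrite fubini_tonelli1// /fubini_F/=.
transitivity (\int[distribution P U']_u (`|u|%:E * \int[P]_w (g (Y w))%:E))%E.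
  apply: eq_integral => u _; rewrite /h/=.
  under eq_integral do rewrite EFinM.
  rewrite ge0_integralZl//; last by move=> y _; rewrite lee_fin.
  by rewrite ge0_integral_distribution.
rewrite ge0_integralZr//; last 2 first.
- by apply: measurableT_comp.
- by apply: integral_ge0 => w _; rewrite lee_fin.
rewrite ge0_integral_distribution//; last first.
  by apply: measurableT_comp.
by congr (_ * _)%E; apply: eq_integral => w _ /=; rewrite ger0_norm.
Qed.

End independence.

(** * Almost sure comparison of events *)

Section measure_complements.
Context (d : measure_display) (T : measurableType d) (R : realType).
Variable P : probability T R.

Lemma ae_eq_measure (A A' : set T) : measurable A -> measurable A' ->
  {ae P, forall w, A w <-> A' w} -> P A = P A'.
Proof.
move=> mA mA' AA'.
have indE X : measurable X -> (\int[P]_w (\1_X w)%:E = P X)%E.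
  by move=> mX; rewrite integral_indic// setIT.
rewrite -!indE//.
apply: ge0_ae_eq_integral => //.
- exact/measurable_EFinP/measurable_indic.
- exact/measurable_EFinP/measurable_indic.
- apply: filterS AA' => w AA' _ /=; congr EFin; rewrite !indicE.
  by congr ((_ : bool)%:R); apply/idP/idP; rewrite !inE => ?; apply/AA'.
Qed.

Lemma ae_imply (Q Q' : T -> Prop) : (forall w, Q w -> Q' w) ->
  {ae P, forall w, Q w} -> {ae P, forall w, Q' w}.
Proof. by move=> QQ'; apply: negligibleS => w; apply: contra_not; exact: QQ'. Qed.

Lemma ae_imply2 (Q1 Q2 Q' : T -> Prop) : (forall w, Q1 w -> Q2 w -> Q' w) ->
  {ae P, forall w, Q1 w} -> {ae P, forall w, Q2 w} -> {ae P, forall w, Q' w}.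
Proof. by move=> QQ'; exact: filterS2. Qed.

End measure_complements.

(** * Continuous Brownian motion and independence of its increments from the past *)

Record continuous_brownian_motion (d : measure_display) (T : measurableType d)
    (R : realType) (P : probability T R) (B : R -> T -> R) : Prop := {
  cbm_measurable : forall t, measurable_fun setT (B t) ;
  cbm_start : forall w, B 0 w = 0 ;
  cbm_continuous : forall w, continuous (B ^~ w) ;
  cbm_independent_increments :
    forall (n : nat) (t : nat -> R) (A : nat -> set R),
      0 <= t 0%N -> (forall k, t k <= t k.+1) ->
      (forall k, measurable (A k)) ->
      P [set w | forall k, (k < n)%N -> A k (B (t k.+1) w - B (t k) w)] =
      (\prod_(k < n) P [set w | A k (B (t k.+1) w - B (t k) w)%R])%E ;
  cbm_normal_increments :
    forall (s t : R) (A : set R), 0 <= s -> s < t -> measurable A ->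
      P [set w | A (B t w - B s w)] = normal_prob 0 (Num.sqrt (t - s)) A
}.

Section increments.
Context (d : measure_display) (T : measurableType d) (R : realType).
Variables (P : probability T R) (B : R -> T -> R).
Hypothesis hB : continuous_brownian_motion P B.

Let mB t : measurable_fun setT (B t) := cbm_measurable hB t.

(** The augmentation by null sets before the right limit is taken. An event of the usual
    augmentation at time t belongs to this sigma-algebra for every s > t. *)
Definition augmented_filtration (X : R -> T -> R) (s : R) : set (set T) :=
  <<s natural_filtration X s `|` P.-negligible >>.

Let grid_rectangle (t : nat -> R) n : set (set T) := [set D |
  exists2 A : nat -> set R, (forall k, measurable (A k)) &
    D = [set w | forall k, (k < n)%N -> A k (B (t k.+1) w - B (t k) w)]].

Let incr_measurable (s t : R) C : measurable C ->
  measurable [set w | C (B t w - B s w)].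
Proof.
move=> mC; rewrite -[X in measurable X]setTI.
exact: (measurable_funB (mB t) (mB s)).
Qed.

Let grid_rectangle_measurable t n : grid_rectangle t n `<=` measurable.
Proof.
move=> _ [A mA ->].
rewrite (_ : mkset _ =
    \bigcap_(k in `I_n) [set w | A k (B (t k.+1) w - B (t k) w)])//.
by apply: bigcap_measurableType => k _; exact: incr_measurable.
Qed.

Let grid_rectangle_setI t n : setI_closed (grid_rectangle t n).
Proof.
move=> _ _ [A mA ->] [A' mA' ->]; exists (fun k => A k `&` A' k).
  by move=> k; exact: measurableI.
apply/seteqP; split => [w [wA wA'] k kn|w h]; first by split; [exact: wA|exact: wA'].
by split => k kn; have [] := h _ kn.
Qed.

(** First pi-lambda step: the rectangles in the increments along the grid form a pi-system, and for
    a rectangle the claim is independence of increments on a longer grid. *)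
Let grid_independent (t : nat -> R) n (s' : R) (C : set R) :
  0 <= t 0%N -> (forall k, t k <= t k.+1) -> t n <= s' -> measurable C ->
  let E := [set w | C (B s' w - B (t n) w)] in
  forall D, <<s grid_rectangle t n >> D ->
    measurable D /\ (P (D `&` E) = P D * P E)%E.
Proof.
move=> t0 tmon ts mC E; apply: g_sigma_algebra_independent.
- exact: incr_measurable.
- exact: grid_rectangle_setI.
- exact: grid_rectangle_measurable.
move=> _ [A mA ->].
(* The grid is prolonged by [s'] after [t n], and [C] constrains the increment from [t n] to [s'];
   from there on [t'] is constant, hence still monotone. *)
pose t' k := if (k <= n)%N then t k else s'.
pose A' k := if (k < n)%N then A k else C.
have t'E k : (k <= n)%N -> t' k = t k by rewrite /t' => ->.
have A'E k : (k < n)%N -> A' k = A k by rewrite /A' => ->.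
have t'n : t' n.+1 = s' by rewrite /t' ltnn.
have A'n : A' n = C by rewrite /A' ltnn.
have t'mon k : t' k <= t' k.+1.
  rewrite /t'; case: (ltngtP k n) => [kn|kn|->] //.
have mA' k : measurable (A' k) by rewrite /A'; case: ifP.
rewrite (cbm_independent_increments hB)//.
have := cbm_independent_increments hB n.+1 (t := t') (A := A').
rewrite t'E// => /(_ t0 t'mon mA').
rewrite big_ord_recr/= A'n t'n t'E//.
rewrite (eq_bigr (fun k : 'I_n => P [set w | A k (B (t k.+1) w - B (t k) w)]));
  last by move=> k _; rewrite A'E// !t'E// ltnW.
move=> <-; congr (P _); apply/seteqP; split => [w [wA wE] k|w wA].
    rewrite ltnS leq_eqVlt => /predU1P[->|kn]; first by rewrite A'n t'n t'E.
    by rewrite A'E// !t'E ?(ltnW kn)//; exact: wA.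
  split => [k kn|].
    by have := wA k (leqW kn); rewrite A'E// !t'E ?(ltnW kn)//.
  by have := wA _ (ltnSn n); rewrite A'n t'n t'E.
Qed.

Let cylinder (us : seq (R * set R)) : set T :=
  [set w | forall p, p \in us -> p.2 (B p.1 w)].

Let cylinder_base s (us : seq (R * set R)) :=
  forall p, p \in us -> 0 <= p.1 <= s /\ measurable p.2.

(** The times of [us], sorted and preceded by 0. The default value of [nth] makes [s] the next grid
    point and keeps the grid constant afterwards. *)
Let grid s (us : seq (R * set R)) k : R := nth s (0 :: sort <=%R (map fst us)) k.

(** Since B starts at 0, its value at a grid point is the sum of the preceding increments; so a
    cylinder set is an event about the increments along the grid. *)
Let cylinder_grid s us : 0 <= s -> cylinder_base s us ->
  [/\ grid s us 0%N = 0, grid s us (size us).+1 = s,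
     forall k, grid s us k <= grid s us k.+1 &
     <<s grid_rectangle (grid s us) (size us).+1 >> (cylinder us)].
Proof.
move=> s0 hus; set t := grid s us; set n := (size us).+1.
have szs : size (0 :: sort <=%R (map fst us)) = n by rewrite /= size_sort size_map.
have tn : t n = s by rewrite /t /grid nth_default// szs.
have t0 : t 0%N = 0 by [].
have us_s u : u \in sort <=%R (map fst us) -> 0 <= u <= s.
  by rewrite mem_sort => /mapP[p /hus[+ _] ->].
have tmon k : t k <= t k.+1.
  have [kn|nk] := ltnP k.+1 n.
    rewrite /t /grid; apply: (@sorted_leq_nth _ <=%R) => //.
    - exact: le_trans.
    - rewrite /= path_min_sorted; first exact/sort_sorted/le_total.
      by apply/allP => u /us_s /andP[].
    - by rewrite inE szs ltnW.
    - by rewrite inE szs.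
  rewrite [leRHS]/t /grid nth_default ?szs//.
  have [kn|nk'] := ltnP k n; last by rewrite /t /grid nth_default ?szs.
  have : t k \in (0 :: sort <=%R (map fst us)) by rewrite mem_nth ?szs.
  by rewrite inE => /predU1P[->//|/us_s /andP[]].
split => //.
have incr_meas k : (k < n)%N ->
    measurable_fun setT ((fun w => B (t k.+1) w - B (t k) w) :
      g_sigma_algebraType (grid_rectangle t n) -> R).
  move=> kn _ C mC; rewrite setTI; apply: sub_sigma_algebra.
  exists (fun j => if j == k then C else setT).
    by move=> j; case: ifP.
  apply/seteqP; split => [w wC j jn|w /(_ _ kn)]; last by rewrite eqxx.
  by case: eqP => // ->.
have B_meas k : (k <= n)%N ->
    measurable_fun setT (B (t k) : g_sigma_algebraType (grid_rectangle t n) -> R).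
  move=> kn.
  rewrite (_ : B (t k) = fun w => \sum_(i < k) (B (t i.+1) w - B (t i) w)).
    by apply: measurable_sum => i; apply: incr_meas; exact: leq_trans kn.
  apply/funext => w.
  by rewrite -(big_mkord xpredT (fun i => B (t i.+1) w - B (t i) w))
    telescope_sumr// t0 (cbm_start hB) subr0.
(* The induction runs over lists of constraints contained in [us], while the grid stays that of the
   full list [us]. *)
have: {subset us <= us} by [].
elim: {1 3}us => [_|p ps ih psus].
  rewrite (_ : cylinder _ = setT).
    exact: (@measurableT _ (g_sigma_algebraType _)).
  by apply/seteqP.
rewrite (_ : cylinder _ = B p.1 @^-1` p.2 `&` cylinder ps).
  apply: (@measurableI _ (g_sigma_algebraType _)); last first.
    by apply: ih => q qps; apply: psus; rewrite inE qps orbT.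
  have pus : p \in us by apply: psus; rewrite inE eqxx.
  have : p.1 \in (0 :: sort <=%R (map fst us)).
    by rewrite inE mem_sort map_f ?orbT.
  move=> /(nthP s)[k]; rewrite szs => kn kp.
  have := B_meas k (ltnW kn) measurableT p.2.
  rewrite setTI /t /grid kp; apply.
  by have [] := hus _ pus.
apply/seteqP; split => [w h|w [h1 h2] q].
  by split; [apply: h; rewrite inE eqxx|move=> q qps; apply: h; rewrite inE qps orbT].
by rewrite inE => /predU1P[->//|]; exact: h2.
Qed.

Hypothesis Pcomplete : measure_is_complete P.

(** Second pi-lambda step, with the pi-system of measurable sets that coincide with a cylinder set
    up to a null set. It contains the generators of the augmented sigma-algebra, the null sets being
    measurable by completeness. *)
Lemma increment_independent (s s' : R) (C : set R) (D : set T) :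
  0 <= s -> s <= s' -> measurable C -> augmented_filtration B s D ->
  let E := [set w | C (B s' w - B s w)] in
  measurable D /\ (P (D `&` E) = P D * P E)%E.
Proof.
move=> s0 ss' mC FD E.
pose G := [set A | measurable A /\ exists2 us, cylinder_base s us &
  {ae P, forall w, A w <-> cylinder us w}].
have mE : measurable E by exact: incr_measurable.
apply: (@g_sigma_algebra_independent _ _ _ P G E) => //.
- move=> A A' [mA [us hus Aus]] [mA' [us' hus' Aus']].
  split; first exact: measurableI.
  exists (us ++ us').
    by move=> p; rewrite mem_cat => /orP[/hus|/hus'].
  apply: filterS2 Aus Aus' => w Aw A'w; split.
    move=> [/Aw h /A'w h'] p; rewrite mem_cat => /orP[]; [exact: h|exact: h'].
  move=> h; split; [apply/Aw|apply/A'w] => p pu; apply: h.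
    by rewrite mem_cat pu.
  by rewrite mem_cat pu orbT.
- by move=> A [].
- move=> A [mA [us hus Aus]].
  have [t0 tn tmon cyl] := cylinder_grid s0 hus.
  have := @grid_independent (grid s us) (size us).+1 s' C.
  rewrite t0 tn => /(_ (lexx _) tmon ss' mC _ cyl)[mcyl cylE].
  rewrite (ae_eq_measure mA mcyl Aus) -cylE; apply: ae_eq_measure.
  + exact: measurableI.
  + exact: measurableI.
  + by apply: filterS Aus => w [h1 h2]; split => -[wA wE]; split => //; [exact: h1|exact: h2].
- move: D FD; apply: smallest_sub; first exact: smallest_sigma_algebra.
  move=> A [|nA]; last first.
    apply: sub_sigma_algebra; split; first exact: Pcomplete.
    (* A null set is matched with an empty cylinder: B at time 0 is required to lie in [set0]. *)
    exists [:: (0, set0)].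
      by move=> p; rewrite inE => /eqP ->; rewrite /= lexx.
    apply: negligibleS nA => w /=; apply: contra_notP => nAw; split => // h.
    by have := h (0, set0); rewrite inE eqxx => /(_ isT).
  move: A; apply: smallest_sub; first exact: smallest_sigma_algebra.
  move=> A [u /= us [C' mC' <-]]; rewrite setTI; apply: sub_sigma_algebra; split.
    by rewrite -[X in measurable X]setTI; exact: mB.
  exists [:: (u, C')].
    by move=> p; rewrite inE => /eqP ->; split => //; move: us; rewrite in_itv.
  apply: aeW => w; split; first by move=> h p; rewrite inE => /eqP ->.
  by move=> h; exact: (h (u, C') (mem_head _ _)).
Qed.

End increments.

Lemma ge0_integral_normal_increment (d : measure_display) (T : measurableType d)
    (R : realType) (P : probability T R) (B : R -> T -> R) (s t : R)
    (g : R -> R) :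
  continuous_brownian_motion P B -> 0 <= s -> s < t ->
  measurable_fun setT g -> (forall y, 0 <= g y) ->
  (\int[P]_w (g (B t w - B s w))%:E =
   \int[normal_prob 0 (Num.sqrt (t - s))]_y (g y)%:E)%E.
Proof.
move=> hB s0 st mg g0.
have mY : measurable_fun setT ((fun w => B t w - B s w) : T -> measurableTypeR R).
  by apply: (@measurable_funB _ _ R); exact: cbm_measurable hB _.
pose Y : {mfun T >-> measurableTypeR R} :=
  HB.pack (fun w => B t w - B s w) (isMeasurableFun.Build _ _ _ _ _ mY).
transitivity (\int[distribution P Y]_y (g y)%:E)%E.
  rewrite ge0_integral_distribution//; first exact/measurable_EFinP.
apply: eq_measure_integral => A mA _.
exact: cbm_normal_increments hB _ _ _ s0 st mA.
Qed.

(** * The exponential martingales *)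

Section exponential_martingale.
Context (d : measure_display) (T : measurableType d) (R : realType).
Variables (P : probability T R) (B : R -> T -> R).
Hypothesis hB : continuous_brownian_motion P B.
Hypothesis Pcomplete : measure_is_complete P.

Local Notation F := (augmented_filtration P B).

Let mB t : measurable_fun setT (B t) := cbm_measurable hB t.

Definition expmart (theta t : R) (w : T) : R :=
  expR (theta * B t w - theta ^+ 2 * t / 2).

Lemma measurable_expmart (theta t : R) : measurable_fun setT (expmart theta t).
Proof.
apply: measurableT_comp => //; apply: measurable_funB => //.
exact: measurable_funM.
Qed.

Lemma augmented_filtration_measurable (s : R) D : 0 <= s -> F s D -> measurable D.
Proof.
move=> s0 FD.
by have [] := increment_independent hB Pcomplete s0 (lexx s) (@measurableT _ R) FD.
Qed.

Lemma augmented_filtrationS (s t : R) : s <= t -> F s `<=` F t.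
Proof.
move=> st; apply: smallest_sub; first exact: smallest_sigma_algebra.
move=> A [nA|nA]; apply: sub_sigma_algebra; [left|by right].
move: A nA; apply: smallest_sub; first exact: smallest_sigma_algebra.
move=> A [u /= us uA]; apply: sub_sigma_algebra; exists u => //=.
move: us; rewrite !in_itv/= => /andP[-> /le_trans]; exact.
Qed.

(** The martingale property, stated through integrals over past events instead of conditional
    expectations. The value at [t] is the value at [s] times a function of [B t - B s] that has mean
    1 and is independent of the past. *)
Lemma expmart_martingale (theta s t : R) D : 0 <= s -> s <= t -> F s D ->
  (\int[P]_w (expmart theta t w * \1_D w)%:E =
   \int[P]_w (expmart theta s w * \1_D w)%:E)%E.
Proof.
move=> s0; rewrite le_eqVlt => /predU1P[->//|st] FD.
pose g y := expR (theta * y - theta ^+ 2 * (t - s) / 2).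
have mg : measurable_fun setT g.
  apply: measurableT_comp => //; apply: measurable_funB => //.
have g0 y : 0 <= g y by exact: expR_ge0.
have mD : measurable D by exact: augmented_filtration_measurable FD.
pose U w := expmart theta s w * \1_D w.
have mU : measurable_fun setT U.
  by apply: measurable_funM; [exact: measurable_expmart|exact: measurable_indic].
have U0 w : 0 <= U w by rewrite mulr_ge0// expR_ge0.
(* [U] is measurable for the augmented sigma-algebra at time [s], which is what makes it independent
   of the increment. *)
have FU C : measurable C -> F s (U @^-1` C).
  move=> mC; rewrite -[X in F s X]setTI.
  pose T' := g_sigma_algebraType (natural_filtration B s `|` P.-negligible).
  suff : measurable_fun [set: T'] (U : T' -> R) by apply.
  apply: measurable_funM; last exact: (measurable_indic (T := T')).
  apply: measurableT_comp => //; apply: measurable_funB => //.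
  apply: measurable_funM => //.
  move=> _ C' mC'; rewrite setTI; apply: sub_sigma_algebra; left.
  apply: sub_sigma_algebra; exists s; first by rewrite /= in_itv/= s0 lexx.
  by exists C' => //; rewrite setTI.
rewrite (_ : (fun w => _) = fun w => (U w * g (B t w - B s w))%:E); last first.
  apply/funext => w; rewrite /U mulrAC; congr (_ * _)%:E.
  by rewrite /expmart /g -expRD; congr expR; ring.
rewrite ge0_integralM_independent//.
- rewrite (ge0_integral_normal_increment hB)//.
  by rewrite integral_expR_normal_prob ?mule1// subr_gt0.
- exact: measurable_funB.
- move=> C C' mC mC'.
  by have [] := increment_independent hB Pcomplete s0 (ltW st) mC' (FU _ mC).
Qed.

Lemma integral_expmart (theta t : R) : 0 <= t -> (\int[P]_w (expmart theta t w)%:E = 1)%E.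
Proof.
move=> t0.
have FT : F 0 setT by exact: (@measurableT _ (g_sigma_algebraType _)).
have := expmart_martingale theta (lexx 0) t0 FT.
under eq_integral do rewrite indicT mulr1.
move=> ->; under eq_integral.
  move=> w _; rewrite indicT mulr1 /expmart (cbm_start hB) !mulr0 mul0r subr0 expR0.
  over.
rewrite integral_cst// mul1e; exact: probability_setT.
Qed.

Lemma measurable_comp_nat (f : nat -> T -> R) (nu : T -> nat) :
  (forall k, measurable_fun setT (f k)) ->
  (forall k, measurable [set w | (nu w <= k)%N]) ->
  measurable_fun setT (fun w => f (nu w) w).
Proof.
move=> mf mnu _ C mC; rewrite setTI.
rewrite (_ : _ @^-1` _ = \bigcup_k ((nu @^-1` [set k]) `&` f k @^-1` C)).
  apply: bigcupT_measurable => k; apply: measurableI.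
    have -> : nu @^-1` [set k] =
        [set w | (nu w <= k)%N] `&` \bigcap_(j in `I_k) ~` [set w | (nu w <= j)%N].
      apply/seteqP; split => [w /= nuk|w /= [nuk h]].
        split; first by rewrite nuk.
        by move=> j /= jk; apply/negP; rewrite nuk -ltnNge.
      apply/eqP; rewrite eqn_leq nuk/= leqNgt; apply/negP => /[dup] nuk'.
      by move=> /(h (nu w)); apply => /=.
    apply: measurableI => //; apply: bigcap_measurableType => j _.
    exact: measurableC.
  by rewrite -[X in measurable X]setTI; exact: mf.
apply/seteqP; split => [w wC|w [k _ [/= <-]]//].
by exists (nu w).
Qed.

(** Optional stopping with finitely many values: on each event where [nu] equals k, the martingale
    property replaces the time [k%:R * h] by the terminal time [n%:R * h]. *)
Lemma integral_expmart_discrete (theta : R) (h : R) (nu : T -> nat) (n : nat) :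
  0 <= h -> (forall w, nu w <= n)%N ->
  (forall k, F (k%:R * h) [set w | (nu w <= k)%N]) ->
  (\int[P]_w (expmart theta ((nu w)%:R * h) w)%:E = 1)%E.
Proof.
move=> h0 nun Fnu.
have kh0 k : 0 <= k%:R * h by rewrite mulr_ge0.
have Fk k : F (k%:R * h) (nu @^-1` [set k]).
  have := Fnu k; case: k => [|k] Fk.
    rewrite (_ : _ @^-1` _ = [set w | (nu w <= 0)%N])//.
    by apply/seteqP; split => w /=; rewrite leqn0 => /eqP.
  rewrite (_ : _ @^-1` _ =
      [set w | (nu w <= k.+1)%N] `\` [set w | (nu w <= k)%N]).
    apply: (@measurableD _ (g_sigma_algebraType _)) => //.
    by apply: augmented_filtrationS (Fnu k); rewrite ler_wpM2r// ler_nat.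
  apply/seteqP; split => w /=.
    by move=> ->; rewrite leqnn ltnn.
  move=> [nuk /negP]; rewrite -ltnNge => knu.
  by apply/eqP; rewrite eqn_leq nuk.
have mk k : measurable (nu @^-1` [set k]).
  exact: augmented_filtration_measurable (Fk k).
have sumE (f : nat -> T -> R) w :
    f (nu w) w = \sum_(k < n.+1) f k w * \1_(nu @^-1` [set nat_of_ord k]) w.
  rewrite (bigD1 (Ordinal (nun w : nu w < n.+1)%N))//= big1 ?addr0.
    by rewrite indicE mem_set ?mulr1.
  move=> k /eqP knu; rewrite indicE memNset ?mulr0//= => nuk.
  by apply: knu; exact: val_inj.
have mf t k : measurable_fun setT
    (fun w => (expmart theta t w * \1_(nu @^-1` [set k]) w)%:E).
  apply/measurable_EFinP/measurable_funM; first exact: measurable_expmart.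
  exact: measurable_indic.
have f0 t k w : (0 <= (expmart theta t w * \1_(nu @^-1` [set k]) w)%:E)%E.
  by rewrite lee_fin mulr_ge0// expR_ge0.
transitivity (\int[P]_w (expmart theta (n%:R * h) w)%:E)%E; last first.
  exact: integral_expmart.
under eq_integral do
  rewrite (sumE (fun k => expmart theta (k%:R * h))) -sumEFin.
under [RHS]eq_integral do
  rewrite (sumE (fun=> expmart theta (n%:R * h))) -sumEFin.
rewrite !ge0_integral_sum//; apply: eq_bigr => k _.
apply/esym/expmart_martingale => //.
by rewrite ler_wpM2r// ler_nat -ltnS.
Qed.

End exponential_martingale.

(** * Optional stopping in continuous time *)

Section optional_stopping.
Context (d : measure_display) (T : measurableType d) (R : realType).
Variables (P : probability T R) (B : R -> T -> R).
Hypothesis hB : continuous_brownian_motion P B.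
Hypothesis Pcomplete : measure_is_complete P.
Variable tau : T -> R.
Hypothesis stop_tau : stopping_time P B tau.

Local Notation F := (augmented_filtration P B).
Local Notation M := (expmart B).

Let tau0 w : 0 <= tau w. Proof. by have [] := stop_tau. Qed.

(** The event is a union of events [tau w <= u] with u < s, each already known at time [s]; the
    strict inequality thus removes the right limit. *)
Lemma stopping_time_lt (s : R) : F s [set w | tau w < s].
Proof.
rewrite (_ : mkset _ = \bigcup_j [set w | tau w <= s - j.+1%:R^-1]).
  apply: (@bigcupT_measurable _ (g_sigma_algebraType _)) => j.
  have [h|h] := leP 0 (s - j.+1%:R^-1).
    have [_ /(_ _ h)] := stop_tau; apply => /=.
    by rewrite ltrBlDr ltrDl.
  (* At a negative time the event is empty because [tau] is nonnegative. *)
  rewrite (_ : mkset _ = set0); first exact: (@measurable0 _ (g_sigma_algebraType _)).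
  by apply/seteqP; split => w //= /(le_trans (tau0 w)); rewrite leNgt h.
apply/seteqP; split => w /=.
  by move=> /ltr_add_invr[k /ltW h]; exists k => //=; rewrite lerBrDr.
by move=> [j _ /= /le_lt_trans]; apply; rewrite ltrBlDr ltrDl.
Qed.

(* The cap makes the discretised time bounded; it is inactive for large m. *)
Definition discretized (m : nat) (w : T) : nat :=
  minn (Num.truncn (tau w * m.+1%:R)).+1 (m.+1 * m.+1)%N.

Definition discretized_time (m : nat) (w : T) : R :=
  (discretized m w)%:R * m.+1%:R^-1.

(** Times are rounded strictly upwards, so below the cap the discretised time is at most a grid
    point exactly when [tau] lies strictly before it. *)
Lemma discretized_stopping m k :
  F (k%:R * m.+1%:R^-1) [set w | (discretized m w <= k)%N].
Proof.
have [kcap|capk] := leqP (m.+1 * m.+1)%N k.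
  rewrite (_ : mkset _ = setT); first exact: (@measurableT _ (g_sigma_algebraType _)).
  by apply/seteqP; split => w //= _; rewrite geq_min kcap orbT.
rewrite (_ : mkset _ = [set w | tau w < k%:R * m.+1%:R^-1]).
  exact: stopping_time_lt.
apply/seteqP; split => w /=.
  rewrite geq_min leqNgt (leqNgt _ k) capk orbF -leqNgt truncn_lt_nat ?mulr_ge0//.
  by rewrite ltr_pdivlMr.
rewrite ltr_pdivlMr// => h.
by rewrite geq_min truncn_lt_nat ?mulr_ge0// h.
Qed.

Lemma discretized_time_le m w : discretized_time m w <= tau w + m.+1%:R^-1.
Proof.
rewrite ler_pdivrMr// mulrDl mulVf ?pnatr_eq0//.
apply: (@le_trans _ _ (Num.truncn (tau w * m.+1%:R)).+1%:R).
  by rewrite ler_nat geq_minl.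
by rewrite -natr1 lerD2r truncn_le mulr_ge0.
Qed.

(** The cap [m.+1 * m.+1] corresponds to the time [m.+1], whence the bound on [tau w]. *)
Lemma discretized_time_gt m w : tau w < m.+1%:R -> tau w < discretized_time m w.
Proof.
move=> tm; rewrite ltr_pdivlMr// /discretized.
rewrite natr_min lt_min truncnS_gt/= natrM ltr_pM2r//.
Qed.

Lemma cvg_discretized_time w : discretized_time ^~ w @ \oo --> tau w.
Proof.
apply: (@squeeze_cvgr _ _ _ _ (cst (tau w)) (fun m => tau w + m.+1%:R^-1)).
- near=> m; rewrite discretized_time_le andbT ltW// discretized_time_gt//.
  near: m; have [n _ h] := nbhs_infty_gtr (tau w); exists n => // m /= nm.
  by rewrite (lt_trans (h _ nm))// ltr_nat.
- exact: cvg_cst.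
- rewrite -[X in _ --> X]addr0; apply: cvgD; [exact: cvg_cst|exact: cvg_harmonic].
Unshelve. all: by end_near. Qed.

Lemma measurable_discretized (f : R -> T -> R) m :
  (forall t, measurable_fun setT (f t)) ->
  measurable_fun setT (fun w => f (discretized_time m w) w).
Proof.
move=> mf; apply: (@measurable_comp_nat _ _ _ (fun k => f (k%:R * m.+1%:R^-1))
  (discretized m)) => //.
move=> k; have kh : 0 <= k%:R * m.+1%:R^-1 :> R by rewrite mulr_ge0// invr_ge0.
exact: (augmented_filtration_measurable hB Pcomplete kh (@discretized_stopping m k)).
Qed.

Lemma measurable_stopped (f : R -> T -> R) :
  (forall t, measurable_fun setT (f t)) -> (forall w, continuous (f ^~ w)) ->
  measurable_fun setT (fun w => f (tau w) w).
Proof.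
move=> mf cf.
apply: (@measurable_fun_cvg _ _ _ _ (fun m w => f (discretized_time m w) w)).
  by move=> m; exact: measurable_discretized.
move=> w _; apply: (cvg_comp (discretized_time ^~ w) (f ^~ w)).
  exact: cvg_discretized_time.
exact: cf.
Qed.

Lemma continuous_expmart theta w : continuous (fun t => M theta t w).
Proof.
move=> t; apply: continuous_comp; last exact: continuous_expR.
apply: cvgB; first by apply: cvgM; [exact: cvg_cst|exact: cbm_continuous hB _ _].
by apply: cvgM; [apply: cvgM; [exact: cvg_cst|exact: cvg_id]|exact: cvg_cst].
Qed.

Lemma cvg_expmart_discretized theta w :
  M theta (discretized_time m w) w @[m --> \oo] --> M theta (tau w) w.
Proof.
apply: (cvg_comp (discretized_time ^~ w) (fun t => M theta t w)).
  exact: cvg_discretized_time.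
exact: continuous_expmart.
Qed.

Lemma measurable_expmart_stopped theta :
  measurable_fun setT (fun w => M theta (tau w) w).
Proof.
apply: measurable_stopped; first by move=> t; exact: (measurable_expmart hB).
exact: continuous_expmart.
Qed.

Lemma integral_expmart_discretized theta m :
  (\int[P]_w (M theta (discretized_time m w) w)%:E = 1)%E.
Proof.
apply: (@integral_expmart_discrete _ _ _ _ _ hB Pcomplete theta _ _ (m.+1 * m.+1)%N).
- by rewrite invr_ge0.
- by move=> w; exact: geq_minr.
- exact: discretized_stopping.
Qed.

Lemma integral_expmart_stopped_le1 theta :
  (\int[P]_w (M theta (tau w) w)%:E <= 1)%E.
Proof.
have mf m : measurable_fun setT (fun w => (M theta (discretized_time m w) w)%:E).
  apply/measurable_EFinP/measurable_discretized => t; exact: (measurable_expmart hB).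
have f0 m w : setT w -> (0 <= (M theta (discretized_time m w) w)%:E)%E.
  by rewrite lee_fin expR_ge0.
have := fatou P measurableT mf f0.
have -> : limn_einf (fun m => \int[P]_w (M theta (discretized_time m w) w)%:E)%E = 1%E.
  apply: (cvg_limn_einf_sup (l := 1%E) _).1.
  by under eq_fun do rewrite integral_expmart_discretized; exact: cvg_cst.
apply: le_trans; rewrite le_eqVlt; apply/orP; left; apply/eqP.
apply: eq_integral => w _; apply/esym.
apply: (cvg_limn_einf_sup (l := (M theta (tau w) w)%:E) _).1.
by apply: cvg_EFin; [exact: nearW|exact: cvg_expmart_discretized].
Qed.

(* The discretisations may overshoot any bound on M at tau, so they are truncated
   at c; the truncation error is at most M ^+ 2 / c, and M ^+ 2 is, up to a bounded
   factor, the exponential martingale with parameter 2 theta. *)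
Lemma integral_expmart_stopped_bounded theta (n c0 : R) :
  (forall w, tau w <= n) -> (forall w, M theta (tau w) w <= c0) ->
  (\int[P]_w (M theta (tau w) w)%:E = 1)%E.
Proof.
move=> taun Mc0; apply/eqP; rewrite eq_le integral_expmart_stopped_le1/=.
set I := (\int[P]_w _)%E.
have I1 : (I <= 1)%E by exact: integral_expmart_stopped_le1.
have I0 : (0 <= I)%E by apply: integral_ge0 => w _; rewrite lee_fin expR_ge0.
have [r Ir] : exists r, I = r%:E.
  by move: I0 I1; case: I => // r _ _; exists r.
(* [M theta ^+ 2] is exp (theta^2 t) times the martingale with parameter [2 * theta]. Discretised
   times are at most [n + 1], so [K] bounds this factor. *)
pose K := expR (theta ^+ 2 * (n + 1)).
have K0 : 0 < K by exact: expR_gt0.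
(* The truncated integrals tend to [r] by dominated convergence, and truncation at [c] costs at most
   [K / c] of the total mass 1. *)
have key c : 0 < c -> c0 <= c -> 1 <= r + K / c.
  move=> c_gt0 c0c.
  pose f m w := Num.min (M theta (discretized_time m w) w) c.
  have f0 m w : 0 <= f m w by rewrite le_min expR_ge0 ltW.
  have mM th m : measurable_fun setT (fun w => M th (discretized_time m w) w).
    by apply: measurable_discretized => t; exact: (measurable_expmart hB).
  have mf m : measurable_fun setT (EFin \o f m).
    by apply/measurable_EFinP/measurable_minr => //; exact: measurable_cst.
  have mMtau := measurable_expmart_stopped theta.
  have [] := @dominated_convergence _ _ _ P setT measurableT (fun m => EFin \o f m)
    (fun w => (M theta (tau w) w)%:E) (cst c%:E) mf.
  - exact/measurable_EFinP.
  - apply: aeW => w _; apply: cvg_EFin; first exact: nearW.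
    rewrite (_ : M theta (tau w) w = Num.min (M theta (tau w) w) c); last first.
      by rewrite min_l// (le_trans (Mc0 w)).
    apply: (cvg_comp (fun m => M theta (discretized_time m w) w) (idfun \min cst c)).
      exact: cvg_expmart_discretized.
    by apply: (@continuous_min R R^o idfun (cst c)); [exact: cvg_id|exact: cvg_cst].
  - exact: finite_measure_integrable_cst.
  - apply: aeW => w m _ /=; rewrite lee_fin ger0_norm//.
    by rewrite /f ge_min lexx orbT.
  move=> _ _ fcvg.
  rewrite -lee_fin EFinD -Ir addeC.
  have : ((K / c)%:E + \int[P]_w (f m w)%:E)%E @[m --> \oo] --> ((K / c)%:E + I)%E.
    by apply: cvgeD => //; exact: cvg_cst.
  apply: cvge_ge; apply: nearW => m.
  rewrite -(integral_expmart_discretized theta m).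
  have <- : (\int[P]_w ((K / c)%:E * (M (2 * theta) (discretized_time m w) w)%:E) =
      (K / c)%:E)%E.
    rewrite ge0_integralZl//; last 3 first.
    - exact/measurable_EFinP.
    - by move=> w _; rewrite lee_fin expR_ge0.
    - by rewrite lee_fin divr_ge0// ltW.
    by rewrite integral_expmart_discretized mule1.
  rewrite -ge0_integralD//; last 4 first.
  - by move=> w _; rewrite -EFinM lee_fin mulr_ge0 ?expR_ge0// divr_ge0// ltW.
  - by apply/measurable_EFinP/measurable_funM.
  - by move=> w _; rewrite lee_fin.
  - exact: mf.
  apply: ge0_le_integral => //.
  - by move=> w _; rewrite lee_fin expR_ge0.
  - exact/measurable_EFinP.
  - apply/measurable_EFinP/measurable_funD; first exact: measurable_funM.
    exact/measurable_EFinP.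
  move=> w _; rewrite -EFinM -EFinD lee_fin.
  set t := discretized_time m w.
  have tn : t <= n + 1.
    rewrite (le_trans (discretized_time_le m w))// lerD//.
    by rewrite invf_le1// ler1n.
  have sqM : M theta t w ^+ 2 <= K * M (2 * theta) t w.
    rewrite /M -expRM_natl -expRD ler_expR.
    have : theta ^+ 2 * t <= theta ^+ 2 * (n + 1) by rewrite ler_wpM2l// sqr_ge0.
    lra.
  rewrite /f -/t; have [Mc|cM] := leP (M theta t w) c.
    by rewrite lerDr mulr_ge0 ?expR_ge0// divr_ge0// ltW.
  (* Where M exceeds [c], M is at most its square divided by [c]. *)
  apply: (@le_trans _ _ (M theta t w ^+ 2 / c)).
    by rewrite ler_pdivlMr// expr2 ler_wpM2l ?expR_ge0// ltW.
  rewrite (@le_trans _ _ (K * M (2 * theta) t w / c))//.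
    by rewrite ler_wpM2r// invr_ge0 ltW.
  by rewrite mulrAC lerDl ltW.
rewrite Ir lee_fin leNgt; apply/negP => r1.
have e0 : 0 < 1 - r by rewrite subr_gt0.
(* With this [c] the error [K / c] is at most half of [1 - r], which contradicts [key] when r <
   1. *)
pose c := Num.max c0 (2 * K / (1 - r)).
have cK : 2 * K / (1 - r) <= c by rewrite le_max lexx orbT.
have c_gt0 : 0 < c by apply: lt_le_trans cK; rewrite divr_gt0// mulr_gt0.
have := key c c_gt0; rewrite le_max lexx => /(_ isT).
have : K / c <= (1 - r) / 2.
  rewrite ler_pdivrMr//; move: cK; rewrite ler_pdivrMr//; lra.
lra.
Qed.

End optional_stopping.

(** * Hitting times of a single continuous path *)

Section path_hitting.
Context (R : realType).
Implicit Types (f : R -> R) (a t : R).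

Definition path_hitting f a : \bar R :=
  ereal_inf [set t%:E | t in [set t : R | 0 <= t /\ a <= f t]].

Lemma path_hitting_le f a t : 0 <= t -> a <= f t -> (path_hitting f a <= t%:E)%E.
Proof. by move=> t0 aft; apply: ereal_inf_lbound; exists t. Qed.

Lemma path_hitting_ge0 f a : (0 <= path_hitting f a)%E.
Proof. by apply: le_ereal_inf_tmp => _ [t [t0 _] <-]; rewrite lee_fin. Qed.

Lemma path_hitting_before f a t : 0 <= t -> (t%:E < path_hitting f a)%E -> f t < a.
Proof.
move=> t0; apply: contraTT; rewrite -!leNgt => aft; exact: path_hitting_le.
Qed.

(** Otherwise continuity keeps the path below [a] on an interval to the right of [t], and the
    infimum would be larger. *)
Lemma path_hitting_attained f a t : continuous f ->
  path_hitting f a = t%:E -> a <= f t.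
Proof.
move=> cf ht; rewrite leNgt; apply/negP => fta.
have [e /= e0 He] : nbhs t [set u | f u < a] by exact: (cvgr_lt (f t)) (cf t) _ fta.
suff : ((t + e)%:E <= path_hitting f a)%E by rewrite ht lee_fin gerDl leNgt e0.
apply: le_ereal_inf_tmp => _ [u [u0 afu] <-]; rewrite lee_fin leNgt; apply/negP => ute.
have tu : t <= u by rewrite -lee_fin -ht; exact: path_hitting_le.
suff : f u < a by rewrite ltNge afu.
by apply: He; rewrite /ball/= distrC ger0_norm ?subr_ge0// ltrBlDl.
Qed.

(** A path above [a] at a time t > 0 is above [a] slightly earlier too, strictly before the hitting
    time; at time 0 the bound is [f 0 < a]. *)
Lemma path_hitting_le_level f a t : continuous f -> f 0 < a -> 0 <= t ->
  (t%:E <= path_hitting f a)%E -> f t <= a.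
Proof.
move=> cf f0a; rewrite le_eqVlt => /predU1P[<- _|t0]; first exact: ltW.
move=> tle; rewrite leNgt; apply/negP => aft.
have [e /= e0 He] : nbhs t [set u | a < f u] by exact: (cvgr_gt (f t)) (cf t) _ aft.
pose u := Num.max 0 (t - e / 2).
have u0 : 0 <= u by rewrite le_max lexx.
have ut : u < t by rewrite gt_max t0/= ltrBlDr ltrDl divr_gt0.
have : f u < a.
  by apply: path_hitting_before => //; apply: lt_le_trans tle; rewrite lte_fin.
apply/negP; rewrite -leNgt ltW//; apply: He; rewrite /ball/=.
rewrite ger0_norm ?subr_ge0 ?(ltW ut)// ltrBlDr -ltrBlDl.
by rewrite (@lt_le_trans _ _ (t - e / 2))// ?le_max ?lexx ?orbT//; lra.
Qed.

(** Describes hitting by time [t] through countably many conditions at rational times. These may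
    slightly exceed [t]; the offset [k0] keeps them below any prescribed later time. *)
Lemma path_hitting_leP f a t k0 : continuous f -> 0 <= t ->
  (path_hitting f a <= t%:E)%E <->
  (forall k, exists q : rat, [/\ 0 <= ratr q :> R,
    ratr q < t + (k0 + k).+1%:R^-1 & a - k.+1%:R^-1 < f (ratr q)]).
Proof.
move=> cf t0; split => [htt k|hq].
  have [u hu] : exists u, path_hitting f a = u%:E.
    by move: htt (path_hitting_ge0 f a); case: path_hitting => // u _ _; exists u.
  have u0 : 0 <= u by rewrite -lee_fin -hu path_hitting_ge0.
  have ut : u <= t by rewrite -lee_fin -hu.
  have afu : a - k.+1%:R^-1 < f u.
    by rewrite ltrBlDr (le_lt_trans (path_hitting_attained cf hu))// ltrDl.
  have [e /= e0 He] : nbhs u [set v | a - k.+1%:R^-1 < f v].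
    exact: (cvgr_gt (f u)) (cf u) _ afu.
  (* The rational is taken to the right of the hitting time, so it is nonnegative even when that
     time is 0. *)
  have /rat_in_itvoo[q] : u < Num.min (u + e) (t + (k0 + k).+1%:R^-1).
    by rewrite lt_min ltrDl e0/= (le_lt_trans ut)// ltrDl.
  rewrite in_itv/= lt_min => /and3P[uq que qt]; exists q; split => //.
    by rewrite (le_trans u0)// ltW.
  by apply: He; rewrite /ball/= distrC ger0_norm ?subr_ge0 ?(ltW uq)// ltrBlDl.
rewrite leNgt; apply/negP => tht.
have [t' tt' t'h] : exists2 t', t < t' & (t'%:E < path_hitting f a)%E.
  move: tht; case: path_hitting => [h||//].
    by rewrite lte_fin => th; exists ((t + h) / 2); rewrite ?lte_fin; lra.
  by move=> _; exists (t + 1); rewrite ?ltry// ltrDl.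
have t'0 : 0 <= t' by rewrite (le_trans t0)// ltW.
(* If the level is not reached by some t' > t, the maximum of the path over [0, t'] lies strictly
   below [a]; for large k the condition at rational times contradicts this. *)
have [c] := @EVT_max R f 0 t' t'0 (continuous_subspaceT cf).
rewrite in_itv/= => /andP[c0 ct'] fc.
have fca : f c < a.
  by apply: path_hitting_before => //; apply: le_lt_trans t'h; rewrite lee_fin.
have [k1 hk1] := ltr_add_invr fca.
have [k2 hk2] := ltr_add_invr tt'.
have [q [q0 qt]] := hq (maxn k1 k2).
apply/negP; rewrite -leNgt.
have qt' : ratr q <= t'.
  rewrite ltW// (lt_trans qt)// (le_lt_trans _ hk2)// lerD2l lef_pV2 ?posrE//.
  by rewrite ler_nat ltnS (leq_trans (leq_maxr k1 k2))// leq_addl.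
rewrite (le_trans (fc _ _))//; first by rewrite in_itv/= q0.
rewrite lerBrDr ltW// (le_lt_trans _ hk1)// lerD2l lef_pV2 ?posrE//.
by rewrite ler_nat ltnS leq_maxl.
Qed.

End path_hitting.

(** * Hitting events and the augmented filtration *)

Section hitting_stopping.
Context (d : measure_display) (T : measurableType d) (R : realType).
Variables (P : probability T R) (X : R -> T -> R).
Hypothesis Xcont : {ae P, forall w, continuous (fun t : R => X (Num.max t 0) w)}.

(** [D'] is obtained from [D] by adding and removing negligible sets, which the augmentation
    contains. *)
Lemma augmented_filtration_ae (s : R) (D D' : set T) :
  augmented_filtration P X s D -> {ae P, forall w, D w <-> D' w} ->
  augmented_filtration P X s D'.
Proof.
move=> FD DD'.
have neg A : A `<=` ~` [set w | D w <-> D' w] -> augmented_filtration P X s A.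
  by move=> h; apply: sub_sigma_algebra; right; exact: negligibleS DD'.
have -> : D' = (D `|` (D' `\` D)) `\` (D `\` D').
  apply/seteqP; split => w.
    by move=> D'w; split => [|[]//]; have [Dw|Dw] := pselect (D w); [left|right].
  by move=> [[Dw|[]//]] nD; apply: contrapT => D'w; apply: nD.
apply: (@measurableD _ (g_sigma_algebraType _)).
  apply: (@measurableU _ (g_sigma_algebraType _)) => //.
  by apply: neg => w [? nDw] [_ h]; apply/nDw/h.
by apply: neg => w [? nDw] [h _]; apply/nDw/h.
Qed.

Lemma hitting_time_le_augmented (a s t : R) : 0 <= t -> t < s ->
  augmented_filtration P X s [set w | (hitting_time X a w <= t%:E)%E].
Proof.
move=> t0 ts.
(* With this [k0] every rational time entering [D] is smaller than [s]. *)
have [k0 hk0] := ltr_add_invr ts.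
pose D := \bigcap_k \bigcup_(q in [set q : rat | 0 <= ratr q :> R /\
  ratr q < t + (k0 + k).+1%:R^-1]) [set w | a - k.+1%:R^-1 < X (ratr q) w].
apply: (@augmented_filtration_ae _ D); last first.
  apply: filterS Xcont => w cX.
  have hE : hitting_time X a w = path_hitting (fun t : R => X (Num.max t 0) w) a.
    rewrite /hitting_time /path_hitting; congr (ereal_inf (image _ _)).
    by apply/seteqP; split => u /= [u0]; rewrite max_l.
  rewrite /= hE; split => [Dw|/(path_hitting_leP a k0 cX t0) h].
    apply/(path_hitting_leP a k0 cX t0).
    move=> k; have [q [q0 qt] /= aq] := Dw k I.
    by exists q; split => //; rewrite max_l.
  move=> k _; have [q [q0 qt aq]] := h k; exists q => //=.
  by rewrite max_l in aq.
apply: (@bigcapT_measurable _ (g_sigma_algebraType _)) => k.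
rewrite bigcup_mkcond.
apply: (@bigcupT_measurable_rat _ (g_sigma_algebraType _)) => q.
case: ifPn => [/set_mem[q0 qt]|_]; last exact: (@measurable0 _ (g_sigma_algebraType _)).
apply: sub_sigma_algebra; left; apply: sub_sigma_algebra.
exists (ratr q).
  rewrite /= in_itv/= q0 ltW// (lt_trans qt)// (le_lt_trans _ hk0)//.
  by rewrite lerD2l lef_pV2 ?posrE// ler_nat ltnS leq_addr.
exists `]a - k.+1%:R^-1, +oo[%classic; first exact: measurable_itv.
by rewrite setTI; apply/seteqP; split => w /=; rewrite in_itv/= andbT.
Qed.

End hitting_stopping.

(** * Laplace transform of the hitting time *)

Section hitting_laplace.
Context (d : measure_display) (T : measurableType d) (R : realType).
Variables (P : probability T R) (B : R -> T -> R).
Hypothesis hB : continuous_brownian_motion P B.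
Hypothesis Pcomplete : measure_is_complete P.
Variable a : R.
Hypothesis a0 : 0 < a.

Local Notation M := (expmart B).
Local Notation hit := (hitting_time B a).

Let B0a w : B 0 w < a. Proof. by rewrite (cbm_start hB). Qed.

Let hit0 w : (0 <= hit w)%E. Proof. exact: path_hitting_ge0. Qed.

Let hit_Ny w : hit w != -oo%E.
Proof. by rewrite -ltNye (lt_le_trans _ (hit0 w))// ltNyr. Qed.

Definition capped_hitting (n : nat) (w : T) : R := fine (Order.min (hit w) n%:R%:E).

Let cappedE n w : (capped_hitting n w)%:E = Order.min (hit w) n%:R%:E.
Proof.
rewrite fineK// ge0_fin_numE; first by rewrite gt_min ltry orbT.
by rewrite le_min hit0 lee_fin ler0n.
Qed.

Lemma capped_hitting_stopping n : stopping_time P B (capped_hitting n).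
Proof.
split => [w|t t0 s /= ts].
  by rewrite -lee_fin cappedE le_min hit0 lee_fin ler0n.
have [nt|tn] := leP n%:R t.
  rewrite (_ : mkset _ = setT); first exact: (@measurableT _ (g_sigma_algebraType _)).
  by apply/seteqP; split => w //= _; rewrite -lee_fin cappedE ge_min lee_fin nt orbT.
rewrite (_ : mkset _ = [set w | (hit w <= t%:E)%E]).
  apply: hitting_time_le_augmented => //; apply: aeW => w u.
  apply: (@continuous_comp _ _ _ (fun t : R => Num.max t 0) (B ^~ w)).
    by apply: (@continuous_max R R^o idfun (cst 0)); [exact: cvg_id|exact: cvg_cst].
  exact: (cbm_continuous hB).
apply/seteqP; split => w /=.
  by rewrite -lee_fin cappedE ge_min lee_fin (leNgt n%:R) tn orbF.
by rewrite -lee_fin cappedE ge_min => ->.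
Qed.

Lemma expmart_capped_le theta n w : 0 <= theta ->
  M theta (capped_hitting n w) w <=
  expR (theta * a) * expR (- (theta ^+ 2 * capped_hitting n w / 2)).
Proof.
move=> theta0; rewrite -expRD ler_expR lerD2r ler_wpM2l//.
apply: (@path_hitting_le_level _ (B ^~ w)) => //; first exact: (cbm_continuous hB).
  by have [] := capped_hitting_stopping n.
by rewrite cappedE ge_min lexx.
Qed.

Definition discount_hitting (theta : R) (w : T) : R :=
  if hit w is h%:E then expR (- (theta ^+ 2 * h / 2)) else 0.

(** If the level is reached, the sequence is eventually constant and B equals [a] at the hitting
    time. If not, the capped time is [n] and the bound [expmart_capped_le] decays geometrically. *)
Lemma cvg_expmart_capped theta w : 0 < theta ->
  M theta (capped_hitting n w) w @[n --> \oo] -->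
  expR (theta * a) * discount_hitting theta w.
Proof.
move=> theta0; rewrite /discount_hitting.
have := hit_Ny w; case hw : (hit w) => [h| |]// _.
  have Bh : B h w = a.
    apply/eqP; rewrite eq_le; apply/andP; split.
      apply: (@path_hitting_le_level _ (B ^~ w)) => //; first exact: (cbm_continuous hB).
        by rewrite -lee_fin -hw.
      by rewrite (_ : path_hitting _ _ = h%:E).
    by apply: (@path_hitting_attained _ (B ^~ w)) hw; exact: (cbm_continuous hB).
  apply: cvg_near_cst; near=> n.
  have hn : h <= n%:R by near: n; exact: nbhs_infty_ger.
  have -> : capped_hitting n w = h.
    by apply: EFin_inj; rewrite cappedE hw min_l// lee_fin.
  by rewrite /expmart Bh expRD.
rewrite mulr0; pose q := expR (- (theta ^+ 2 / 2)).
have q0 : 0 < q by exact: expR_gt0.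
have q1 : q < 1 by rewrite -expR0 ltr_expR oppr_lt0 divr_gt0// exprn_gt0.
apply: (@squeeze_cvgr _ _ _ _ (cst 0) (fun n => expR (theta * a) * q ^+ n)).
- near=> n; rewrite expR_ge0/= (le_trans (expmart_capped_le _ _ (ltW theta0)))//.
  have -> : capped_hitting n w = n%:R.
    by apply: EFin_inj; rewrite cappedE hw min_r// leey.
  rewrite ler_wpM2l ?expR_ge0// /q -expRM_natl ler_expR.
  by rewrite le_eqVlt; apply/orP; left; apply/eqP; ring.
- exact: cvg_cst.
- rewrite -[X in _ --> X](mulr0 (expR (theta * a))); apply: cvgM; first exact: cvg_cst.
  by apply: cvg_expr; rewrite ger0_norm// ltW.
Unshelve. all: by end_near. Qed.

Lemma measurable_discount_hitting theta : 0 < theta ->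
  measurable_fun setT (discount_hitting theta).
Proof.
move=> theta0.
rewrite (_ : discount_hitting theta = fun w =>
    expR (- (theta * a)) * (expR (theta * a) * discount_hitting theta w)).
  apply: measurable_funM => //.
  apply: (@measurable_fun_cvg _ _ _ _ (fun n w => M theta (capped_hitting n w) w)).
    move=> n; apply: (measurable_expmart_stopped hB Pcomplete).
    exact: capped_hitting_stopping.
  by move=> w _; exact: cvg_expmart_capped.
by apply/funext => w; rewrite mulrA -expRD addNr expR0 mul1r.
Qed.

Lemma discount_hitting_ge0 theta w : 0 <= discount_hitting theta w.
Proof. by rewrite /discount_hitting; case: hit => // h; exact: expR_ge0. Qed.

Lemma integral_discount_hitting theta : 0 < theta ->
  (\int[P]_w (discount_hitting theta w)%:E = (expR (- (theta * a)))%:E)%E.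
Proof.
move=> theta0.
have mG := measurable_discount_hitting theta0.
pose c := expR (theta * a).
have c0 : 0 <= c by exact: expR_ge0.
have Mc n w : M theta (capped_hitting n w) w <= c.
  rewrite (le_trans (expmart_capped_le _ _ (ltW theta0)))// ler_piMr//.
  rewrite -[leRHS]expR0 ler_expR oppr_le0 divr_ge0// mulr_ge0 ?sqr_ge0//.
  by have [] := capped_hitting_stopping n.
have int1 n : (\int[P]_w (M theta (capped_hitting n w) w)%:E = 1)%E.
  apply: (integral_expmart_stopped_bounded hB Pcomplete (capped_hitting_stopping n)
    (n := n%:R) (c0 := c)) => // w.
  by rewrite -lee_fin cappedE ge_min lexx orbT.
have [] := @dominated_convergence _ _ _ P setT measurableT
  (fun n w => (M theta (capped_hitting n w) w)%:E)
  (fun w => (c * discount_hitting theta w)%:E) (cst c%:E).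
- move=> n; apply/measurable_EFinP/(measurable_expmart_stopped hB Pcomplete).
  exact: capped_hitting_stopping.
- by apply/measurable_EFinP/measurable_funM.
- apply: aeW => w _; apply: cvg_EFin; first exact: nearW.
  exact: cvg_expmart_capped.
- exact: finite_measure_integrable_cst.
- by apply: aeW => w n _ /=; rewrite lee_fin ger0_norm// expR_ge0.
move=> _ _; under eq_fun do rewrite int1.
move=> /(cvg_unique _ (cvg_cst 1%E)) /esym.
under eq_integral do rewrite EFinM.
rewrite ge0_integralZl//; last 2 first.
- exact/measurable_EFinP.
- by move=> w _; rewrite lee_fin discount_hitting_ge0.
set I := (\int[P]_w _)%E => cI.
have : ((expR (- (theta * a)))%:E * (c%:E * I) = (expR (- (theta * a)))%:E * 1)%E.
  by rewrite cI.
by rewrite muleA -EFinM -expRD addNr expR0 mul1e mule1.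
Qed.

(* Letting theta tend to 0 in the Laplace transform. *)
Lemma hitting_time_ae_finite : {ae P, forall w, (hit w < +oo)%E}.
Proof.
have mhit : measurable [set w | (hit w < +oo)%E].
  rewrite (_ : mkset _ = \bigcup_n [set w | (hit w <= n%:R%:E)%E]).
    apply: bigcupT_measurable => n.
    have n1 : 0 <= n.+1%:R :> R by [].
    apply: (augmented_filtration_measurable hB Pcomplete n1).
    apply: hitting_time_le_augmented => //; last by rewrite ltr_nat.
    apply: aeW => w u.
    apply: (@continuous_comp _ _ _ (fun t : R => Num.max t 0) (B ^~ w)).
      by apply: (@continuous_max R R^o idfun (cst 0)); [exact: cvg_id|exact: cvg_cst].
    exact: (cbm_continuous hB).
  apply/seteqP; split => w /=.
    move=> hoo; have := hit_Ny w; move: hoo; case hw : (hit w) => [h| |]// _ _.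
    exists (Num.truncn h).+1 => //=; rewrite hw lee_fin ltW// truncnS_gt//.
  by move=> [n _ /= /le_lt_trans]; apply; exact: ltry.
set E := mkset _ in mhit *.
(* Combines exp (- theta a) >= 1 - theta a with the fact that the discount factor is at most the
   indicator of [E]. *)
have PE theta : 0 < theta -> 1 - theta * a <= fine (P E).
  move=> theta0; rewrite -lee_fin fineK ?fin_num_measure//.
  rewrite (@le_trans _ _ (expR (- (theta * a)))%:E)//.
    by rewrite lee_fin (le_trans _ (expR_ge1Dx _)).
  rewrite -(integral_discount_hitting theta0).
  have -> : P E = (\int[P]_w (\1_E w)%:E)%E by rewrite integral_indic// setIT.
  apply: ge0_le_integral => //.
  - by move=> w _; rewrite lee_fin discount_hitting_ge0.
  - by apply/measurable_EFinP; exact: measurable_discount_hitting.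
  - exact/measurable_EFinP/measurable_indic.
  move=> w _; rewrite lee_fin indicE /discount_hitting.
  have := hit0 w; case hw : (hit w) => [h| |]// h0.
  rewrite mem_set; last by rewrite /E/= hw ltry.
  rewrite -[leRHS]expR0 ler_expR oppr_le0 divr_ge0// mulr_ge0 ?sqr_ge0//.
have PE1 : P E = 1%E.
  apply/eqP; rewrite eq_le probability_le1//= -(fineK (fin_num_measure P E mhit)).
  rewrite lee_fin leNgt; apply/negP => lt1.
  (* For this theta, [theta * a] is half of the missing mass [1 - fine (P E)], so the bound fails
     unless that mass is 0. *)
  have := PE ((1 - fine (P E)) / (2 * a)).
  rewrite divr_gt0 ?subr_gt0 ?mulr_gt0// => /(_ isT).
  rewrite (_ : _ / (2 * a) * a = (1 - fine (P E)) / 2); last by field; rewrite gt_eqF.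
  lra.
exists (~` E); split => //; first exact: measurableC.
by rewrite probability_setC// PE1 subee.
Qed.

End hitting_laplace.

(** * The completed probability space *)

Section completion_theory.
Context (d : measure_display) (T : measurableType d) (R : realType).
Variable P : probability T R.

Local Notation T' := (caratheodory_type (P^*)%mu).

Lemma completionE (A : set T) : measurable A -> completion P A = P A.
Proof. by move=> mA; rewrite /completion /completed_measure_extension measurable_mu_extE. Qed.

Lemma measurable_completion (A : set T) : measurable A -> measurable (A : set T').
Proof. by move=> mA; apply: sub_caratheodory; exact: sub_sigma_algebra. Qed.

Lemma measurable_fun_completion (f : T -> R) :
  measurable_fun setT f -> measurable_fun [set: T'] (f : T' -> R).
Proof. by move=> mf _ C mC; apply: measurable_completion; exact: mf. Qed.

Lemma completion_is_complete : measure_is_complete (completion P).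
Proof. exact: measure_is_complete_caratheodory. Qed.

Lemma negligible_completion (A : set T) :
  P.-negligible A -> (completion P).-negligible A.
Proof.
move=> [N [mN PN AN]]; exists N; split => //; first exact: measurable_completion.
by rewrite -PN completionE.
Qed.

Lemma ae_completion (Q : T -> Prop) :
  {ae P, forall w, Q w} -> {ae completion P, forall w, Q w}.
Proof. exact: negligible_completion. Qed.

(** The outer measure is an infimum over countable measurable covers: a null set has covers of
    measure at most [k.+1%:R^-1], and their intersection is measurable and null for [P]. This brings
    almost sure statements back from the completion. *)
Lemma completion_negligible (A : set T) :
  (completion P).-negligible A -> P.-negligible A.
Proof.
move=> [N [_ N0 AN]].
have cover k : exists2 C : set T, measurable C /\ N `<=` C & (P C <= k.+1%:R^-1%:E)%E.
  have : (completion P N < k.+1%:R^-1%:E)%E by rewrite N0 lte_fin.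
  move=> /ereal_inf_lt[_ [F [mF NF] <-] /ltW Fk].
  exists (\bigcup_i F i); first by split => //; exact: bigcupT_measurable.
  apply: le_trans Fk; apply: measure_sigma_subadditive => //.
  exact: bigcupT_measurable.
have {cover}/choice[C hC] k : exists C : set T,
    [/\ measurable C, N `<=` C & (P C <= k.+1%:R^-1%:E)%E].
  by have [C [mC NC] PC] := cover k; exists C.
exists (\bigcap_k C k); split.
- by apply: bigcapT_measurable => k; have [] := hC k.
- have mC : measurable (\bigcap_k C k).
    by apply: bigcapT_measurable => k; have [] := hC k.
  apply/eqP; rewrite eq_le measure_ge0 andbT -(fineK (fin_num_measure P _ mC)).
  rewrite lee_fin leNgt; apply/negP => /ltr_add_invr[k]; rewrite add0r.
  apply/negP; rewrite -leNgt -lee_fin fineK ?fin_num_measure//.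
  have [mCk _ Ck] := hC k; apply: le_trans Ck; apply: le_measure; rewrite ?inE//.
  exact: bigcap_inf.
- by move=> w /AN Nw k _; have [_ NC _] := hC k; exact: NC.
Qed.

End completion_theory.

(** * A version of Brownian motion with all paths continuous *)

Lemma continuous_comp_max (R : realType) (f : R -> R) :
  {within `[0, +oo[, continuous f} -> continuous (fun t : R => f (Num.max t 0)).
Proof.
move=> cf t.
have c0 : continuous (fun u : R => Num.max u 0).
  move=> u; apply: (@continuous_max R R^o idfun (cst 0)); [exact: cvg_id|exact: cvg_cst].
have /subspace_continuousP/(_ (Num.max t 0)) := cf.
rewrite /= in_itv/= andbT le_max lexx orbT => /(_ isT) cft.
apply: cvg_trans cft.
move=> A; rewrite /= /within/= => nA.
have : nbhs t [set u | Num.max u 0 \in `[0, +oo[ -> A (f (Num.max u 0))] by exact: c0 nA.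
apply: filterS => u; apply.
by rewrite in_itv/= andbT le_max lexx orbT.
Qed.

Section continuous_version.
Context (d : measure_display) (T : measurableType d) (R : realType).
Variables (P : probability T R) (B : R -> T -> R).
Hypothesis hB : standard_brownian_motion P B.

Local Notation T' := (caratheodory_type (P^*)%mu).

Lemma continuous_version_ex : exists B' : R -> T' -> R,
  continuous_brownian_motion (completion P) B' /\
  {ae P, forall w, forall t, 0 <= t -> B' t w = B t w}.
Proof.
have [N [mN PN hN]] : P.-negligible (~` [set w | B 0 w = 0 /\
    {within `[0, +oo[, continuous (fun t => B t w)}]).
  have := bm_start hB; have := bm_continuous hB.
  by apply: filterS2 => w h1 h2; split.
have {}hN w : ~ N w -> B 0 w = 0 /\ {within `[0, +oo[, continuous (fun t => B t w)}.
  by move=> nNw; apply: contrapT => h; apply/nNw/hN.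
(* Paths are extended to negative times by their value at 0, and replaced by the zero path on the
   null set [N] of bad paths. *)
pose B' t w := B (Num.max t 0) w * \1_(~` N) w.
have B'E w t : ~ N w -> 0 <= t -> B' t w = B t w.
  by move=> nNw t0; rewrite /B' indicE mem_set// mulr1 max_l.
have B'N w t : N w -> B' t w = 0.
  by move=> Nw; rewrite /B' indicE memNset ?mulr0//=; apply.
have aeB' : {ae P, forall w, forall t, 0 <= t -> B' t w = B t w}.
  exists N; split => // w; apply: contra_notP => nNw t t0; exact: B'E.
have mB' t : measurable_fun setT (B' t).
  apply: measurable_funM; first by apply: (bm_measurable hB); rewrite le_max lexx orbT.
  by apply: measurable_indic; exact: measurableC.
have mBt t : 0 <= t -> measurable_fun setT (B t) by exact: bm_measurable hB t.
have mincr (Y : R -> T -> R) s t C : measurable_fun setT (Y s) ->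
    measurable_fun setT (Y t) -> measurable C -> measurable [set w | C (Y t w - Y s w)].
  move=> mYs mYt mC; rewrite -[X in measurable X]setTI.
  exact: (measurable_funB mYt mYs).
(* Laws of increments transfer because the two processes agree almost surely and the completion
   coincides with [P] on measurable events. *)
have PB' s t C : 0 <= s -> 0 <= t -> measurable C ->
    completion P [set w | C (B' t w - B' s w)] = P [set w | C (B t w - B s w)].
  move=> s0 t0 mC; rewrite completionE; last exact: (mincr B').
  apply: ae_eq_measure; [exact: (mincr B')|by apply: (mincr B) => //; exact: mBt|].
  by apply: filterS aeB' => w h; rewrite /= !h.
exists B'; split => //; split.
- by move=> t; exact: measurable_fun_completion.
- move=> w; have [Nw|nNw] := pselect (N w); first by rewrite B'N.
  by rewrite B'E//; have [] := hN _ nNw.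
- move=> w; have [Nw|nNw] := pselect (N w).
    by rewrite (_ : B' ^~ w = cst 0); [exact: cst_continuous|apply/funext => t; exact: B'N].
  rewrite (_ : B' ^~ w = fun t : R => B (Num.max t 0) w).
    by apply: (@continuous_comp_max _ (B ^~ w)); have [] := hN _ nNw.
  by apply/funext => t; rewrite /B' indicE mem_set// mulr1.
- move=> n t A t0 tmon mA.
  have tk k : 0 <= t k by elim: k => // k /le_trans; apply.
  rewrite (eq_bigr (fun k : 'I_n => P [set w | A k (B (t k.+1) w - B (t k) w)])); last first.
    by move=> k _; exact: PB'.
  apply: (etrans _ (@bm_independent_increments _ _ _ _ _ hB n t A t0 tmon mA)).
  have mset (Y : R -> T -> R) : (forall k, measurable_fun setT (Y (t k))) ->
      measurable [set w | forall k, (k < n)%N -> A k (Y (t k.+1) w - Y (t k) w)].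
    move=> mY; rewrite (_ : mkset _ =
      \bigcap_(k in `I_n) [set w | A k (Y (t k.+1) w - Y (t k) w)])//.
    by apply: bigcap_measurableType => k _; exact: (mincr Y).
  transitivity (P [set w | forall k, (k < n)%N -> A k (B' (t k.+1) w - B' (t k) w)]).
    exact: completionE (mset B' (fun k => mB' (t k))).
  apply: ae_eq_measure; [exact: (mset B')|by apply: (mset B) => k; exact: mBt|].
  by apply: filterS aeB' => w h; split => wA k kn; have := wA k kn; rewrite !h.
- move=> s t A s0 st mA; have t0 := le_trans s0 (ltW st).
  by apply: (etrans (PB' s t A s0 t0 mA)); exact: (bm_normal_increments hB).
Qed.

End continuous_version.

(** * Upper bound for the discounted reward *)

Lemma ge0_ae_eq_integral_complete (d : measure_display) (T : measurableType d)
    (R : realType) (P : probability T R) (f g : T -> R) :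
  measure_is_complete P -> measurable_fun setT f ->
  (forall w, 0 <= f w) -> (forall w, 0 <= g w) ->
  {ae P, forall w, g w = f w} -> (\int[P]_w (g w)%:E = \int[P]_w (f w)%:E)%E.
Proof.
move=> cP mf f0 g0 gf.
have fg : ae_eq P setT (EFin \o f) (EFin \o g).
  by apply: negligibleS gf => w; apply: contra_not => /= ->.
apply: ge0_ae_eq_integral => //.
(* Completeness makes [g] measurable, since it equals the measurable [f] almost everywhere. *)
- by apply: (ae_measurable_fun cP fg); exact/measurable_EFinP.
- exact/measurable_EFinP.
- by move=> w _; rewrite lee_fin.
- by move=> w _; rewrite lee_fin.
- exact: ae_eq_sym.
Qed.

Section call_reward_stopped.
Context (d : measure_display) (T : measurableType d) (R : realType).
Variables (P : probability T R) (rho K sigma x : R) (B : R -> T -> R).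
Hypothesis hB : continuous_brownian_motion P B.
Hypothesis Pcomplete : measure_is_complete P.
Variable tau : T -> R.
Hypothesis stop_tau : stopping_time P B tau.

Local Notation reward := (call_reward rho K (scaled_brownian x sigma B) tau).

Lemma call_reward_ge0 w : 0 <= reward w.
Proof. by rewrite mulr_ge0 ?expR_ge0// le_max lexx orbT. Qed.

Lemma measurable_call_reward_stopped : measurable_fun setT reward.
Proof.
apply: (measurable_stopped hB Pcomplete stop_tau
  (f := fun t w => expR (- rho * t) * Num.max (x + sigma * B t w - K) 0)).
- move=> t; apply: measurable_funM => //; apply: measurable_maxr => //.
  apply: measurable_funB => //; apply: measurable_funD => //.
  by apply: measurable_funM => //; exact: (cbm_measurable hB).
- move=> w t; apply: cvgM.
    apply: continuous_comp; last exact: continuous_expR.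
    by apply: cvgM; [exact: cvg_cst|exact: cvg_id].
  apply: (@continuous_max R R^o (fun t => x + sigma * B t w - K) (cst 0)).
    apply: cvgB; last exact: cvg_cst.
    apply: cvgD; first exact: cvg_cst.
    by apply: cvgM; [exact: cvg_cst|exact: (cbm_continuous hB)].
  exact: cvg_cst.
Qed.

(** When [theta ^+ 2 = 2 * rho], discounting exp (theta b) and exp (- theta b) at [tau] gives the
    exponential martingales with parameters [theta] and [- theta], each of mean at most 1 there. *)
Lemma integral_call_reward_le (theta a1 a2 : R) :
  theta ^+ 2 = 2 * rho -> 0 <= a1 -> 0 <= a2 ->
  (forall b, x + sigma * b - K <= a1 * expR (theta * b) + a2 * expR (- theta * b)) ->
  (\int[P]_w (reward w)%:E <= (a1 + a2)%:E)%E.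
Proof.
move=> theta2 a10 a20 maj.
pose M th w : R := expmart B th (tau w) w.
have mM th : measurable_fun setT (M th).
  exact: (measurable_expmart_stopped hB Pcomplete stop_tau).
have mME th : measurable_fun setT (fun w => (M th w)%:E) by exact/measurable_EFinP.
have M0 th w : (0 <= (M th w)%:E)%E by rewrite lee_fin expR_ge0.
have M1 th : (\int[P]_w (M th w)%:E <= 1)%E.
  exact: (integral_expmart_stopped_le1 hB Pcomplete stop_tau).
apply: (@le_trans _ _ (\int[P]_w
    (a1%:E * (M theta w)%:E + a2%:E * (M (- theta) w)%:E))%E).
  apply: ge0_le_integral => //.
  - by move=> w _; rewrite lee_fin call_reward_ge0.
  - by apply/measurable_EFinP; exact: measurable_call_reward_stopped.
  - by apply/measurable_EFinP/measurable_funD; exact: measurable_funM.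
  move=> w _; rewrite -!EFinM -EFinD lee_fin /call_reward.
  have ME th : th ^+ 2 = 2 * rho ->
      M th w = expR (- rho * tau w) * expR (th * B (tau w) w).
    by move=> th2; rewrite /M /expmart -expRD th2; congr expR; field.
  rewrite !ME ?sqrrN// !(mulrCA _ (expR (- rho * _))) -mulrDr ler_wpM2l ?expR_ge0//.
  (* The majorant is nonnegative, so it dominates the positive part as well. *)
  by rewrite ge_max maj addr_ge0// mulr_ge0// expR_ge0.
rewrite ge0_integralD//; last 4 first.
- by move=> w _; rewrite mule_ge0// lee_fin.
- by apply/measurable_EFinP/measurable_funM.
- by move=> w _; rewrite mule_ge0// lee_fin.
- by apply/measurable_EFinP/measurable_funM.
rewrite !ge0_integralZl// EFinD; apply: leeD.
- by rewrite -[leRHS]mule1; apply: lee_wpmul2l; rewrite ?lee_fin.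
- by rewrite -[leRHS]mule1; apply: lee_wpmul2l; rewrite ?lee_fin.
Qed.

End call_reward_stopped.

(** * The single-agent stopping problem *)

Section call_option.
Context (d : measure_display) (T : measurableType d) (R : realType).
Variables (P : probability T R) (rho K sigma x : R) (B : R -> T -> R).
Hypotheses (rho0 : 0 < rho) (sigma0 : 0 < sigma).
Hypothesis hB : standard_brownian_motion P B.

Local Notation T' := (caratheodory_type (P^*)%mu).
Local Notation X := (scaled_brownian x sigma B).
Local Notation xstar := (K + sigma / Num.sqrt (2 * rho)).
Local Notation theta := (Num.sqrt (2 * rho)).

Let theta0 : 0 < theta. Proof. by rewrite sqrtr_gt0 mulr_gt0. Qed.

Let theta2 : theta ^+ 2 = 2 * rho.
Proof. by rewrite sqr_sqrtr// mulr_ge0// ltW. Qed.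

Let xstarK : xstar - K = sigma / theta. Proof. by rewrite addrC addKr. Qed.

Variable B' : R -> T' -> R.
Hypothesis hB' : continuous_brownian_motion (completion P) B'.
Hypothesis BB' : {ae P, forall w, forall t, 0 <= t -> B' t w = B t w}.

(** Each [X u] is almost surely an affine function of [B' u], so the augmented sigma-algebras of X
    are contained in those of [B'] over the completed space. *)
Lemma stopping_time_continuous_version tau :
  stopping_time P X tau -> stopping_time (completion P) B' tau.
Proof.
move=> [tau0 taum]; split => // t t0 s ts.
have : augmented_filtration P X s [set w | tau w <= t] by exact: taum ts.
have s0 : 0 <= s by rewrite (le_trans t0)// ltW.
move: [set w | _]; apply: smallest_sub; first exact: smallest_sigma_algebra.
move=> A [|nA]; last by apply: sub_sigma_algebra; right; exact: negligible_completion.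
move: A; apply: smallest_sub; first exact: smallest_sigma_algebra.
move=> _ [u /= us [C mC <-]]; rewrite setTI.
apply: (@augmented_filtration_ae _ T' _ (completion P) B' s
  [set w | C (x + sigma * B' u w)]).
  apply: sub_sigma_algebra; left; apply: sub_sigma_algebra; exists u => //.
  exists [set y | C (x + sigma * y)]; last by rewrite setTI.
  rewrite -[X in measurable X]setTI.
  suff : measurable_fun setT (fun y : R => x + sigma * y) by apply.
  by apply: measurable_funD => //; exact: measurable_funM.
apply: (ae_imply _ (ae_completion BB')) => w; move: us; rewrite in_itv/= => /andP[u0 _].
by move=> /(_ u u0) BE; rewrite /= /scaled_brownian BE.
Qed.

Lemma expected_reward_ae tau (f : T' -> R) :
  measurable_fun setT f -> (forall w, 0 <= f w) ->
  {ae P, forall w, call_reward rho K X tau w = f w} ->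
  (expected_reward P rho K X tau = \int[completion P]_w (f w)%:E)%E.
Proof.
move=> mf f0 rf; rewrite /expected_reward unlock.
apply: (ge0_ae_eq_integral_complete (@completion_is_complete _ _ _ P) mf f0).
  by move=> w; exact: call_reward_ge0.
exact: (ae_completion rf).
Qed.

Lemma expected_reward_ge0 tau : (0 <= expected_reward P rho K X tau)%E.
Proof.
rewrite /expected_reward; apply: expectation_ge0 => w.
exact: call_reward_ge0.
Qed.

Lemma expected_reward_le (a1 a2 : R) tau : 0 <= a1 -> 0 <= a2 ->
  (forall b, x + sigma * b - K <= a1 * expR (theta * b) + a2 * expR (- theta * b)) ->
  stopping_time P X tau ->
  (expected_reward P rho K X tau <= (a1 + a2)%:E)%E.
Proof.
move=> a10 a20 maj st.
have cP := @completion_is_complete _ _ _ P.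
have st' := stopping_time_continuous_version st.
rewrite (expected_reward_ae (measurable_call_reward_stopped rho K sigma x hB' cP st')).
- exact: (integral_call_reward_le hB' cP st' theta2).
- by move=> w; exact: call_reward_ge0.
have [tau0 _] := st.
by apply: (ae_imply _ BB') => w h;
  rewrite /call_reward /scaled_brownian h.
Qed.

Definition call_value : R :=
  if xstar <= x then x - K
  else (xstar - K) * expR (theta / sigma * (x - xstar)).

(* Majorise the payoff by its tangent combination of exp (theta b) and
   exp (- theta b) at b = 0, or at the contact point b = (xstar - x) / sigma. *)
Lemma expected_reward_le_value tau : stopping_time P X tau ->
  (expected_reward P rho K X tau <= call_value%:E)%E.
Proof.
move=> st; rewrite /call_value; have [xx|xx] := leP xstar x.
  (* The two summands are the coefficients [a1] and [a2]: their sum matches the payoff at b = 0, and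
     [theta * (a1 - a2) = sigma] matches its slope. Both are nonnegative because [x - K] is at least
     [sigma / theta]. *)
  have -> : x - K = (x - K + sigma / theta) / 2 + (x - K - sigma / theta) / 2 by lra.
  have st0 : 0 < sigma / theta by rewrite divr_gt0.
  apply: expected_reward_le => //; try lra.
  move=> b; have := expR_ge1Dx (theta * b); have := expR_ge1Dx (- theta * b).
  have : sigma * b = sigma / theta * (theta * b) by field; rewrite gt_eqF.
  move: (sigma / theta) st0 xx (expR _) (expR _) => g g0 xx e1 e2 -> h1 h2.
  nra.
(* Below the threshold [a2] is 0, and exp y >= 1 + y with y = theta (b - (xstar - x) / sigma) gives
   the majorisation. *)
rewrite -[X in X%:E]addr0; apply: expected_reward_le => //.
  by rewrite mulr_ge0 ?expR_ge0// xstarK divr_ge0 ?ltW.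
move=> b; rewrite mul0r addr0 -mulrA -expRD xstarK.
have := expR_ge1Dx (theta / sigma * (x - xstar) + theta * b).
have st0 : 0 < sigma / theta by rewrite divr_gt0.
move=> /(ler_wpM2l (ltW st0)); apply: le_trans.
rewrite le_eqVlt; apply/orP; left; apply/eqP.
by field; rewrite !gt_eqF.
Qed.

Let hitting_version : x < xstar -> {ae P, forall w,
  hitting_time X xstar w = hitting_time B' ((xstar - x) / sigma) w}.
Proof.
move=> xx; apply: (ae_imply _ BB') => w h.
rewrite /hitting_time; congr (ereal_inf (image _ _)).
apply/seteqP; split => t /= [t0 ht]; split=> //; move: ht.
  by rewrite /scaled_brownian h// ler_pdivrMr// lerBlDl (mulrC (B t w)).
by rewrite /scaled_brownian h// ler_pdivrMr// lerBlDl (mulrC (B t w)).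
Qed.

Let hitting_immediate : xstar <= x -> {ae P, forall w, hitting_time X xstar w = 0%E}.
Proof.
move=> xx; apply: (ae_imply _ (bm_start hB)) => w B0; apply/eqP; rewrite eq_le.
rewrite (path_hitting_ge0 (X ^~ w)) andbT.
by apply: (@path_hitting_le _ (X ^~ w)) => //; rewrite /scaled_brownian B0 mulr0 addr0.
Qed.

Let level_gt0 : x < xstar -> 0 < (xstar - x) / sigma.
Proof. by move=> xx; rewrite divr_gt0 ?subr_gt0. Qed.

Lemma hitting_xstar_finite : {ae P, forall w, (hitting_time X xstar w < +oo)%E}.
Proof.
have [xx|xx] := leP xstar x.
  by apply: (ae_imply _ (hitting_immediate xx)) => w ->; exact: ltry.
have := hitting_time_ae_finite hB' (@completion_is_complete _ _ _ P) (level_gt0 xx).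
move=> /completion_negligible h.
have {}h : {ae P, forall w, (hitting_time B' ((xstar - x) / sigma) w < +oo)%E} by [].
by apply: (ae_imply2 _ h (hitting_version xx)) => w ? ->.
Qed.

Local Notation taustar := (fun w => fine (hitting_time X xstar w)).

(** [fine] alters the hitting time only where it is infinite, a null event that the augmentation
    absorbs. *)
Lemma hitting_xstar_stopping : stopping_time P X taustar.
Proof.
split => [w|t t0 s ts]; first by rewrite fine_ge0// (path_hitting_ge0 (X ^~ w)).
apply: (@augmented_filtration_ae _ _ _ P X s [set w | (hitting_time X xstar w <= t%:E)%E]).
  apply: hitting_time_le_augmented => //.
  apply: (ae_imply _ (bm_continuous hB)) => w cB u.
  apply: cvgD; first exact: cvg_cst.
  by apply: cvgM; [exact: cvg_cst|exact: (@continuous_comp_max _ (B ^~ w))].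
apply: (ae_imply _ hitting_xstar_finite) => w hoo.
have h0 : (0 <= hitting_time X xstar w)%E := path_hitting_ge0 (X ^~ w) xstar.
by move: hoo h0 => /=; case: hitting_time.
Qed.

(** At or above the threshold, stopping is immediate. Below it, X equals [xstar] when stopped, so
    the reward is [xstar - K] times the discount factor, whose mean is the Laplace transform at
    [theta ^+ 2 / 2 = rho]. *)
Lemma expected_reward_hitting_xstar :
  expected_reward P rho K X taustar = call_value%:E.
Proof.
have st0 : 0 < sigma / theta by rewrite divr_gt0.
rewrite /call_value; have [xx|xx] := leP xstar x.
  have xK : 0 <= x - K by lra.
  rewrite (@expected_reward_ae _ (cst (x - K)))//.
    transitivity ((x - K)%:E * completion P setT)%E.
      exact: (integral_cst (completion P) measurableT (x - K)%:E).
    by rewrite [X in (_ * X)%E](probability_setT (completion P)) mule1.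
  apply: (ae_imply2 _ (hitting_immediate xx) (bm_start hB)) => w hw B0.
  by rewrite /call_reward hw/= mulr0 expR0 mul1r /scaled_brownian B0 mulr0 addr0 max_l.
pose a := (xstar - x) / sigma.
have a0 : 0 < a by exact: level_gt0.
pose G := discount_hitting B' a theta.
have mG : measurable_fun setT G.
  exact: (measurable_discount_hitting hB' (@completion_is_complete _ _ _ P) a0).
have G0 w : 0 <= G w by exact: discount_hitting_ge0.
have xK0 : 0 <= xstar - K by rewrite xstarK ltW.
rewrite (@expected_reward_ae _ (fun w => (xstar - K) * G w)).
- under eq_integral do rewrite EFinM.
  rewrite ge0_integralZl//; last 2 first.
  - exact/measurable_EFinP.
  - by move=> w _; rewrite lee_fin.
  rewrite /G integral_discount_hitting// -?EFinM; last exact: completion_is_complete.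
  congr (_ * expR _)%:E; rewrite /a; field.
  by rewrite !gt_eqF.
- exact: measurable_funM.
- by move=> w; rewrite mulr_ge0.
have h1 := hitting_version xx; have h2 := hitting_xstar_finite.
apply: (ae_imply2 _ (ae_imply2 (fun w => @conj _ _) h1 h2) BB') => w [hE hoo] hBw.
have hE0 : (0 <= hitting_time X xstar w)%E := path_hitting_ge0 (X ^~ w) xstar.
have [h hh] : exists h, hitting_time X xstar w = h%:E.
  by move: hoo hE0; case: hitting_time => // h _ _; exists h.
have h0 : 0 <= h by rewrite -lee_fin -hh.
rewrite /call_reward hh/= /G /discount_hitting /a -hE hh.
have Bh : B' h w = a.
  have hB'w : path_hitting (B' ^~ w) a = h%:E by rewrite -hh hE.
  apply/eqP; rewrite eq_le; apply/andP; split.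
    apply: (@path_hitting_le_level _ (B' ^~ w)) => //; first exact: (cbm_continuous hB').
      by rewrite (cbm_start hB').
    by rewrite hB'w.
  by apply: (@path_hitting_attained _ (B' ^~ w)) => //; exact: (cbm_continuous hB').
rewrite /scaled_brownian -hBw// Bh /a mulrC.
rewrite (_ : x + sigma * ((xstar - x) / sigma) = xstar); last by field; rewrite !gt_eqF.
by rewrite max_l//; congr (_ * expR _); rewrite theta2; field.
Qed.

End call_option.

(** * Reduction of the game to the single-agent problem *)

Lemma sum_deviation (R : realType) (N : nat) (A : Type) (tau : 'I_N -> A)
    (i : 'I_N) (s : A) (u : A -> R) :
  \sum_(j < N | j != i) u (deviation tau i s j) = \sum_(j < N | j != i) u (tau j).
Proof. by apply: eq_bigr => j /negbTE ji; rewrite /deviation ji. Qed.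

Lemma deviation_self (N : nat) (A : Type) (tau : 'I_N -> A) (i : 'I_N) (s : A) :
  deviation tau i s i = s.
Proof. by rewrite /deviation eqxx. Qed.

Theorem proposition2p17 (R : realType) (d : measure_display)
    (Omega : measurableType d) (P : probability Omega R)
    (N : nat) (eta rho K sigma x : R) (B : R -> Omega -> R)
    (hN : (2 <= N)%N) (heta : 0 <= eta) (hrho : 0 < rho) (hK : 0 < K)
    (hsigma : 0 < sigma) (hB : standard_brownian_motion P B) :
  let X := scaled_brownian x sigma B in
  let T := stopping_time P X in
  let xstar := K + sigma / Num.sqrt (2 * rho) in
  (* tau* , with the null event {tau* = +oo} sent to 0 *)
  let taustar := fun w => fine (hitting_time X xstar w) in
  [/\ exact_potential_game T (@J _ _ _ N P rho K eta X) (Phi P rho K X),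
      {ae P, forall w, (hitting_time X xstar w < +oo)%E},
      nash_equilibrium T (@J _ _ _ N P rho K eta X) (fun=> taustar),
      value P rho K X =
        (if xstar <= x then x - K
         else (xstar - K) * expR (Num.sqrt (2 * rho) / sigma * (x - xstar)))%:E
    & (@Phi _ _ _ N P rho K X (fun=> taustar))%:E =
        (N%:R%:E * value P rho K X)%E].
Proof.
move=> X T xstar taustar.
have [B' [hB' BB']] := continuous_version_ex hB.
pose V := call_value rho K sigma x.
pose r tau := expected_reward P rho K X tau.
have rV tau : T tau -> (r tau <= V%:E)%E.
  exact: (expected_reward_le_value K hrho hsigma hB' BB').
have r0 tau : (0 <= r tau)%E by exact: expected_reward_ge0.
have rstar : r taustar = V%:E.
  exact: (expected_reward_hitting_xstar K x hrho hsigma hB hB' BB').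
have Tstar : T taustar.
  exact: (hitting_xstar_stopping rho K x hsigma hB hB' BB').
have valueV : value P rho K X = V%:E.
  rewrite /value; apply/eqP; rewrite eq_le; apply/andP; split.
    by apply: ge_ereal_sup => _ [tau Ttau <-]; exact: rV.
  by rewrite -rstar; apply: ereal_sup_ubound; exists taustar.
(* Rewards lie between 0 and [V], hence are finite, so [fine] loses nothing in the payoffs. *)
have fr_le tau : T tau -> fine (r tau) <= V.
  move=> Ttau; rewrite -lee_fin fineK; first exact: rV.
  by rewrite ge0_fin_numE//; exact: le_lt_trans (rV _ Ttau) (ltry _).
split => //.
- move=> i tau s Ttau Ts; rewrite /J /Phi.
  (* Once the i-th term of [Phi] is split off, the sums over the other players cancel on both sides,
     leaving the change in the reward of player [i]. *)
  rewrite [X in _ = X - _](bigD1 i)//= [X in _ = _ - X](bigD1 i)//=.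
  by rewrite !(sum_deviation tau i s (fine \o r)) deviation_self; ring.
- exact: (hitting_xstar_finite rho K x hsigma hB hB' BB').
- split => // i s Ts; rewrite /J.
  rewrite (sum_deviation (fun=> taustar) i s (fine \o r)) deviation_self lerD2r.
  by rewrite -/(r s) -/(r taustar) rstar fr_le.
- rewrite valueV /Phi (eq_bigr (fun=> V)); last by move=> i _; rewrite -/(r _) rstar.
  by rewrite big_const_ord iter_addr_0 -EFinM mulr_natl.
Qed.
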